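(* For $r>0$, let $\rho_{r,\infty}$ be the normalized area measure on the disk $\{z\in\mathbb C:|z|<r\}$, i.e. $d\rho_{r,\infty}=\frac{dA}{\pi r^2}$ restricted to that disk. Then $\rho_{r,\infty}$ is arithmetic if and only if $r\ge e^{1/2}$.
   Context: A probability measure $\mu$ supported on a compact set $E\subset\mathbb C$ that is symmetric about the real axis is called arithmetic if there exists a sequence of algebraic integers $(\alpha_n)_{n\ge1}$ with the following two properties: 1. For every open neighborhood $U\supset E$ there is $N$ such that all Galois conjugates (over $\mathbb Q$) in $\mathbb C$ of $\alpha_n$ lie in $U$ for all $n\ge N$. 2. The uniform probability measures $[\alpha_n]_\infty=\frac1{\deg\alpha_n}\sum_{\beta}\delta_\beta$, with $\beta$ ranging over the complex conjugates of $\alpha_n$, converge weak-* to $\mu$. *)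

(* Defs.v *)
From HB Require Import structures.
From mathcomp Require Import all_boot all_order all_algebra.
From mathcomp Require Import all_classical all_reals all_analysis.
From mathcomp Require Import measurable_realfun.
From mathcomp Require Import complex ring lra.

Set Implicit Arguments.
Unset Strict Implicit.
Unset Printing Implicit Defensive.

Import Order.TTheory GRing.Theory Num.Theory.
Import numFieldNormedType.Exports.

Local Open Scope classical_set_scope.
Local Open Scope ring_scope.
Local Open Scope complex_scope.

HB.instance Definition _ (R : realType) := NormedModule.copy R[i] R[i]^o.
HB.instance Definition _ (R : realType) :=
  Measurable.copy R[i] (g_sigma_algebraType (@open R[i])).

Section area.
Context {R : realType}.

Definition of_plane (p : measurableTypeR R * measurableTypeR R) : R[i] :=
  p.1 +i* p.2.

Lemma norm_of_plane_le (x y : R) : `|x +i* y| <= (`|x| + `|y|)%:C.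
Proof.
rewrite normc_def lecR.
rewrite -[leRHS]ger0_norm ?addr_ge0// -sqrtr_sqr ler_wsqrtr//.
rewrite sqrrD !real_normK ?num_real// addrAC lerDl.
by rewrite mulrn_wge0// mulr_ge0.
Qed.

Lemma measurable_of_plane : measurable_fun setT of_plane.
Proof.
apply: (@measurability _ _ _ _ _ _ (@open R[i])) => // _ [U oU <-].
rewrite setTI.
pose box (a b : rat) (n : nat) : set (measurableTypeR R * measurableTypeR R) :=
  ball (ratr a : R) n.+1%:R^-1 `*` ball (ratr b : R) n.+1%:R^-1.
have -> : of_plane @^-1` U = \bigcup_a \bigcup_b \bigcup_n
    (if `[< box a b n `<=` of_plane @^-1` U >] then box a b n else set0).
  apply/seteqP; split=> [[x y] Uxy|p [a _ [b _ [n _]]]]; last first.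
    by case: asboolP => // + pbox; exact.
  have : nbhs (x +i* y) U by rewrite nbhsE; exists U.
  rewrite -nbhs_ballE => -[e /= e0 eU].
  have eE : e = (complex.Re e)%:C by rewrite RRe_real// gtr0_real.
  rewrite eE ltcR in e0; rewrite {}eE in eU.
  move: (complex.Re e) e0 eU => {}e e0 eU.
  have [n] : exists n, 0 + n.+1%:R^-1 < e / 4.
    by apply/ltr_add_invr; rewrite divr_gt0.
  have n0 : 0 < n.+1%:R^-1 :> R by rewrite invr_gt0.
  have [a] := @rat_in_itvoo R (x - n.+1%:R^-1) (x + n.+1%:R^-1)
    ltac:(by rewrite ltrD2l gtrN).
  have [b] := @rat_in_itvoo R (y - n.+1%:R^-1) (y + n.+1%:R^-1)
    ltac:(by rewrite ltrD2l gtrN).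
  rewrite !in_itv/= -!ltr_distlC add0r => yb xa ne.
  exists a => //; exists b => //; exists n => //.
  case: asboolP => [_|[]].
    by split; rewrite /ball/= distrC.
  move=> [x' y'] [/= ax' by']; apply: eU.
  rewrite /ball/= /of_plane/=.
  rewrite (_ : _ - _ = (x - x') +i* (y - y'))//.
  apply: le_lt_trans (norm_of_plane_le _ _) _; rewrite ltcR.
  have aux (p q p1 p2 q1 q2 k : R) : k < e / 4 -> q1 < k -> p1 < k ->
    p2 < k -> q2 < k -> q <= q1 + q2 -> p <= p1 + p2 -> p + q < e by lra.
  exact: aux ne yb xa ax' by' (ler_distD _ _ _) (ler_distD _ _ _).
apply: bigcupT_measurable_rat => a; apply: bigcupT_measurable_rat => b.
apply: bigcupT_measurable => n; case: asboolP => // _.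
by apply: measurableX; exact: measurable_ball.
Qed.

Definition area : set R[i] -> \bar R :=
  pushforward (lebesgue_measure \x lebesgue_measure)%E of_plane.


#[local] Hint Resolve measurable_of_plane : core.

Let area0 : area set0 = 0%E.
Proof. exact: measure0. Qed.

Let area_ge0 A : (0 <= area A)%E.
Proof. exact: measure_ge0. Qed.

Let area_sigma_additive : semi_sigma_additive area.
Proof. exact: measure_semi_sigma_additive. Qed.

HB.instance Definition _ := isMeasure.Build _ _ _ area
  area0 area_ge0 area_sigma_additive.

Definition disk (r : R) : set R[i] := [set z | `|z| < r%:C].

Lemma measurable_disk r : measurable (disk r).
Proof.
apply: sub_sigma_algebra; rewrite /disk.
have [r0|r0] := ltP 0 r; last first.
  rewrite (_ : [set _ | _] = set0); first exact: open0.
  apply/seteqP; split=> // z /= zr; have := le_lt_trans (normr_ge0 z) zr.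
  by rewrite ltcR ltNge r0.
rewrite (_ : [set _ | _] = ball (0 : R[i]) r%:C).
  by apply: ball_open; rewrite ltcR.
by apply/seteqP; split=> z; rewrite /ball/= sub0r normrN.
Qed.

Lemma area_disk (r : R) : 0 < r -> area (disk r) = (pi * r ^+ 2)%:E.
Proof.
move=> r0; rewrite /area /pushforward /product_measure1/=.
pose h (x : R) : R := 2 * Num.sqrt (r ^+ 2 - x ^+ 2).
have hE x : lebesgue_measure (xsection (of_plane @^-1` disk r) x) = (h x)%:E.
  rewrite (_ : xsection _ _ =
      `](- Num.sqrt (r ^+ 2 - x ^+ 2)), (Num.sqrt (r ^+ 2 - x ^+ 2))[%classic).
    rewrite lebesgue_measure_itv/= lte_fin /h; case: ltP => [_|].
      by rewrite -EFinB opprK; congr EFin; lra.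
    rewrite -subr_ge0 => h0; congr EFin; apply/esym/eqP; rewrite eq_le.
    by rewrite mulr_ge0// andbT; have := sqrtr_ge0 (r ^+ 2 - x ^+ 2); lra.
  apply/seteqP; split=> y; rewrite /xsection/= inE/= /disk/= normc_def ltcR/=;
    rewrite in_itv/= -ltr_norml.
    rewrite -{1}[r]gtr0_norm// -sqrtr_sqr ltr_sqrt ?exprn_gt0// => xyr.
    by rewrite -sqrtr_sqr ltr_sqrt; nra.
  rewrite -sqrtr_sqr => yx.
  rewrite -{1}[r]gtr0_norm// -sqrtr_sqr ltr_sqrt ?exprn_gt0//.
  have [rx|rx] := ltP 0 (r ^+ 2 - x ^+ 2); first by rewrite ltr_sqrt// in yx; lra.
  by rewrite (ler0_sqrtr rx) ltNge sqrtr_ge0 in yx.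
transitivity (\int[lebesgue_measure]_(x in
    `[(r * sin (- (pi / 2)))%R, (r * sin (pi / 2))%R]) (h x)%:E)%E.
  rewrite [RHS]integral_mkcond/=; apply: eq_integral => x _.
  rewrite hE patchE sinN sin_pihalf mulrN mulr1 mem_setE in_itv/= -ler_norml.
  case: ifPn => //; rewrite -ltNge => rx; congr EFin.
  rewrite /h ler0_sqrtr ?mulr0// subr_le0 -[x ^+ 2]real_normK ?num_real//.
  by rewrite ler_sqr ?nnegrE// ltW.
have pi0 := pi_gt0 R.
have dF (x : R) : is_derive x 1 (fun t : R => r * sin t) (r * cos x).
  by apply: is_derive_eq; rewrite /GRing.scale/=; ring.
have dFE : derive1 (fun t : R => r * sin t) = (fun x : R => r * cos x).
  by apply/funext => x; rewrite derive1E; apply: derive_val.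
have cF : continuous (fun t : R => r * sin t).
  by move=> x; apply: cvgM; [exact: cvg_cst|exact: continuous_sin].
have cF' : continuous (fun t : R => r * cos t).
  by move=> x; apply: cvgM; [exact: cvg_cst|exact: continuous_cos].
have ch : continuous h.
  move=> x; apply: cvgM; first exact: cvg_cst.
  apply: continuous_comp; last exact: sqrt_continuous.
  by apply: cvgB; [exact: cvg_cst|exact: exprn_continuous].
have pi2 : - (pi / 2) < pi / 2 :> R by lra.
have DF x y : derivable_oo_LRcontinuous (fun t : R => r * sin t) x y.
  split; first by move=> z _; have [] := dF z.
  - exact/cvg_at_right_filter/cF.
  - exact/cvg_at_left_filter/cF.
rewrite (@integration_by_substitution_increasing R (fun t : R => r * sin t) h)//; first last.
- exact: continuous_subspaceT.
- by rewrite dFE; apply/cvg_ex; eexists; exact/cvg_at_left_filter/cF'.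
- by rewrite dFE; apply/cvg_ex; eexists; exact/cvg_at_right_filter/cF'.
- by rewrite dFE => x _; exact: cF'.
- by move=> x y xI yI xy; rewrite ltr_pM2l// ltr_sin.
- exact: ltW.
rewrite dFE.
pose g (x : R) := 2 * r ^+ 2 * cos x ^+ 2.
pose G (x : R) := r ^+ 2 * (x + sin x * cos x).
have dG (x : R) : is_derive x 1 G (g x).
  apply: is_derive_eq; rewrite /GRing.scale/= /g.
  have := cos2Dsin2 x; nra.
have cG : continuous G by move=> x; apply/differentiable_continuous/derivable1_diffP;
  have [] := dG x.
transitivity (\int[lebesgue_measure]_(x in
    `[(- (pi / 2))%R, (pi / 2)%R]) (g x)%:E)%E.
  apply: eq_integral.
  move=> x; rewrite inE/= in_itv/= => xI; congr EFin.
  have cx : 0 <= cos x by apply: cos_ge0_pihalf.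
  change (h (r * sin x) * (r * cos x) = g x); rewrite /h /g.
  rewrite (_ : r ^+ 2 - _ = (r * cos x) ^+ 2).
    by rewrite sqrtr_sqr ger0_norm ?mulr_ge0 ?(ltW r0)//; ring.
  have := cos2Dsin2 x; nra.
rewrite (@continuous_FTC2 _ g G)//.
- rewrite -EFinB /G sinN cosN cos_pihalf !mulr0 !addr0 ; congr EFin; lra.
- apply: continuous_subspaceT => x; apply: cvgM; first exact: cvg_cst.
  by apply: (@cvgM _ _ _ _ cos cos); exact: continuous_cos.
- split; first by move=> z _; have [] := dG z.
  - exact/cvg_at_right_filter/cG.
  - exact/cvg_at_left_filter/cG.
- by move=> x _; rewrite derive1E; apply: derive_val.
Qed.

End area.

Section disk_uniform.
Context {R : realType}.

Let norm_ge0 (r : R) : 0 <= (pi * r ^+ 2)^-1.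
Proof. by rewrite invr_ge0 mulr_ge0 ?pi_ge0 ?sqr_ge0. Qed.

(* The proof r0 occurs in the definition only to carry the probability
   structure below. *)
Definition disk_uniform (r : R) (r0 : 0 < r) : set R[i] -> \bar R :=
  mscale (NngNum (norm_ge0 r)) (mrestr area (measurable_disk r)).

Variables (r : R) (r0 : 0 < r).

HB.instance Definition _ := Measure.on (disk_uniform r0).

Let disk_uniform_setT : disk_uniform r0 setT = 1%E.
Proof.
rewrite /disk_uniform /mscale/= /mrestr setTI area_disk// -EFinM mulVf//.
by rewrite mulf_neq0 ?expf_neq0 ?gt_eqF ?pi_gt0.
Qed.

HB.instance Definition _ :=
  Measure_isProbability.Build _ _ _ (disk_uniform r0) disk_uniform_setT.

End disk_uniform.

Section conjugates.
Context {R : realType}.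
Implicit Types z : R[i].

Definition algebraic_integer z := integralOver (intr : int -> R[i]) z.

(* The minimal polynomial over the rationals; 0 if z is transcendental. *)
Definition minpolyQ z : {poly rat} :=
  xget 0 [set p : {poly rat} | [/\ p \is monic, irreducible_poly p
    & root (map_poly (ratr : rat -> R[i]) p) z]].

(* All complex roots of the minimal polynomial; they are simple. *)
Definition galois_conjugates z : seq R[i] :=
  sval (closed_field_poly_normal (map_poly (ratr : rat -> R[i]) (minpolyQ z))).

Definition algdegree z : nat := (size (minpolyQ z)).-1.

Definition conjugate_measure z : set R[i] -> \bar R :=
  mscale ((algdegree z)%:R^-1)%:nng
    (msum (fun k => dirac (nth 0 (galois_conjugates z) k))
       (size (galois_conjugates z))).

HB.instance Definition _ z := Measure.on (conjugate_measure z).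

End conjugates.

Section arithmetic.
Context {R : realType}.

(* Convergence in the weak-* topology of the dual of the space of compactly
   supported continuous functions. *)
Definition weak_star_cvg (mu_ : nat -> {measure set R[i] -> \bar R})
    (mu : {measure set R[i] -> \bar R}) :=
  forall f : R[i] -> R, continuous f ->
    compact (closure [set z | f z != 0]) ->
    (\int[mu_ n]_z (f z)%:E)%E @[n --> \oo] --> (\int[mu]_z (f z)%:E)%E.

Definition conj_symmetric (E : set R[i]) := forall z, E z -> E z^*.

Definition arithmetic_measure (E : set R[i]) (mu : probability R[i] R) :=
  exists alpha : nat -> R[i],
  [/\ forall n, algebraic_integer (alpha n),
      forall U : set R[i], open U -> E `<=` U ->
        exists N : nat, forall n, (N <= n)%N ->
          forall b, b \in galois_conjugates (alpha n) -> U b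
    & weak_star_cvg (fun n => conjugate_measure (alpha n)) mu].

End arithmetic.

(* Main.v *)
Require Import Defs.
From mathcomp Require Import all_boot all_order all_algebra.
From mathcomp Require Import all_classical all_reals all_analysis.
From mathcomp Require Import complex.
From mathcomp Require Import algebraics_fundamentals polyrcf.
From mathcomp Require Import measurable_realfun ring lra zify.
Import Order.TTheory GRing.Theory Num.Theory.
Import numFieldNormedType.Exports.
Import ComplexField.Normc.
Local Open Scope classical_set_scope.
Local Open Scope ring_scope.
Local Open Scope complex_scope.

Set Implicit Arguments.
Unset Strict Implicit.
Unset Printing Implicit Defensive.

(** Cut the disk into [m] annuli of equal mass, with radii
    [tau_j = r * sqrt (j / m)].  Both directions reduce to the size of
    [prod_j tau_j], whose square is [r^(2m) m! / m^m].

    If [r < e^(1/2)], this product is less than 1 for some [m], so that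
    [ln |z|], truncated near 0, has negative integral; but its average over
    the conjugates of a nonzero algebraic integer is nonnegative, because
    their product is a nonzero integer up to sign.

    If [r >= e^(1/2)], the product exceeds 1, and one can choose [sigma_j]
    between consecutive [tau_j] with product at least 1.  Consider the monic
    integer polynomial [P] of degree [m] with alternating signs whose
    coefficient of [w^j] is of the order of
    [(sigma_j * ... * sigma_(m-1))^N], rounded to twice an odd number so that
    Eisenstein's criterion holds at 2.  For large [N], at [w = tau_j^N] the
    [j]-th term dominates, which forces [m] sign changes, hence one real root
    in each [(tau_j^N, tau_(j+1)^N)].  The roots of the irreducible polynomial
    [P(z^N)] are thus spread evenly on [m] circles, one in each annulus. *)

(** * Topology of the complex plane *)

Section complex_plane.
Context {R : realType}.
Implicit Types z w : R[i].

Lemma normr_normc z : `|z| = (normc z)%:C.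
Proof. by []. Qed.

Lemma normc_ge0 z : 0 <= normc z.
Proof. by case: z => x y; exact: sqrtr_ge0. Qed.

Lemma normc_real (x : R) : normc x%:C = `|x|.
Proof. by rewrite /normc/= expr0n/= addr0 sqrtr_sqr. Qed.

Lemma normcX z n : normc (z ^+ n) = normc z ^+ n.
Proof. by elim: n => [|n ih]; rewrite ?expr0 ?normc1// !exprS normcM ih. Qed.

Lemma ler_normc_ReIm (x y : R) : normc (x +i* y) <= `|x| + `|y|.
Proof. by rewrite -lecR; exact: norm_of_plane_le. Qed.

Lemma ler_Re_normc (x y : R) : `|x| <= normc (x +i* y).
Proof. by rewrite -sqrtr_sqr ler_wsqrtr// lerDl sqr_ge0. Qed.

Lemma ler_Im_normc (x y : R) : `|y| <= normc (x +i* y).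
Proof. by rewrite -sqrtr_sqr ler_wsqrtr// lerDr sqr_ge0. Qed.

Lemma nbhs_normcP z (A : set R[i]) :
  nbhs z A <-> exists2 e, 0 < e & forall w, normc (z - w) < e -> A w.
Proof.
rewrite -nbhs_ballE; split=> [[e /= e0 zA]|[e e0 zA]].
  have eE : e = (complex.Re e)%:C by rewrite RRe_real// gtr0_real.
  exists (complex.Re e) => [|w zw]; first by rewrite -ltcR -eE.
  by apply: zA; rewrite /ball/= eE normr_normc ltcR.
exists e%:C => [|w]; first by rewrite /= ltcR.
by rewrite /ball/= normr_normc ltcR; exact: zA.
Qed.

Lemma continuous_normc : continuous (@normc R).
Proof.
move=> z A; rewrite -nbhs_ballE => -[e /= e0 zA].
apply/nbhs_normcP; exists e => // w zw; apply: zA; apply: le_lt_trans zw.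
rewrite ler_distl; apply/andP; split.
  by rewrite lerBlDr -[normc (_ - _)]normcN opprB -{1}(subrKC z w) le_normcD.
by rewrite -{1}(subrKC w z) le_normcD.
Qed.

Lemma continuous_complex : continuous (fun p : R * R => p.1 +i* p.2).
Proof.
move=> [x y] A /nbhs_normcP[e e0 xyA].
have e2_gt0 : 0 < e / 2 by rewrite divr_gt0.
exists (ball x (e / 2), ball y (e / 2)) => [|[x' y'] [/= xx' yy']].
  by split; exact: nbhsx_ballx.
apply: xyA; apply: le_lt_trans (ler_normc_ReIm (x - x') (y - y')) _.
by rewrite [e]splitr ltrD.
Qed.

Lemma diskE (r : R) : disk r = [set z | normc z < r].
Proof. by apply/seteqP; split=> z; rewrite /disk/= normr_normc ltcR. Qed.

Lemma disk0 : disk 0 = set0 :> set R[i].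
Proof.
by rewrite diskE; apply/seteqP; split=> z //=; rewrite ltNge normc_ge0.
Qed.

Lemma sub_disk (r s : R) : r <= s -> disk r `<=` (disk s : set R[i]).
Proof. by move=> rs; rewrite !diskE => z /= zr; exact: lt_le_trans zr rs. Qed.

Lemma open_disk (r : R) : open (disk r : set R[i]).
Proof.
rewrite diskE [X in open X](_ : _ = @normc R @^-1` [set x | x < r])//.
by move/continuousP : continuous_normc; apply; exact: open_lt.
Qed.

Lemma compact_closed_disk (r : R) : compact [set z : R[i] | normc z <= r].
Proof.
have compact_itv : compact `[- r, r]%classic by exact: segment_compact.
have compact_square := continuous_compact
  (continuous_subspaceT continuous_complex)
  (compact_setX compact_itv compact_itv).
apply: (subclosed_compact _ compact_square) => [|[x y] /= xyr].
  apply: (@preimage_closed _ _ (@normc R) [set x | x <= r]) => [z _|].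
    exact: continuous_normc.
  exact: closed_le.
exists (x, y) => //=; split; rewrite /= in_itv/= -ler_norml.
  exact: le_trans (ler_Re_normc x y) xyr.
exact: le_trans (ler_Im_normc x y) xyr.
Qed.

Lemma compact_sub_disk (E : set R[i]) : compact E ->
  \forall r \near +oo, E `<=` disk r.
Proof.
move=> kE; have /compact_bounded : compact (@normc R @` E).
  apply: continuous_compact => //.
  exact/continuous_subspaceT/continuous_normc.
move=> [M [Mr EM]]; near=> r; rewrite diskE => z Ez /=.
apply: (le_lt_trans (ler_norm _)); apply: (@le_lt_trans _ _ (M + 1)).
  by apply: (EM (M + 1)); [rewrite ltrDl|exists z].
by near: r; exact/nbhs_pinfty_gt/num_real.
Unshelve. all: by end_near. Qed.

End complex_plane.

Section compact_support.
Context {R : realType}.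

Definition compact_support {T : topologicalType} (f : T -> R) :=
  compact (closure [set x | f x != 0]).

Lemma eq0_off_support {T : topologicalType} (f : T -> R) x :
  ~ closure [set y | f y != 0] x -> f x = 0.
Proof.
move=> xK; apply/eqP/negPn/negP => fx.
by apply: xK; exact: subset_closure.
Qed.

Lemma compact_support_unif_continuous (f : R[i] -> R) (e : R) :
  continuous f -> compact_support f -> 0 < e ->
  exists2 d : R, 0 < d & forall z w, normc (z - w) < d -> `|f z - f w| < e.
Proof.
move=> cf kf e0; set K := closure [set z | f z != 0].
have near_f (z0 : R[i]) : \forall z \near z0 & d \near (0 : R)^'+,
    forall w, normc (z - w) < d -> `|f z - f w| < e.
  have /cvgrPdist_lt/(_ (e / 2)) := @cf z0.
  rewrite divr_gt0// => /(_ isT)/nbhs_normcP[d d0 fd].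
  exists ([set z | normc (z0 - z) < d / 2], [set x | x < d / 2]) => /=.
    split; last by apply: nbhs_right_lt; rewrite divr_gt0.
    by apply/nbhs_normcP; exists (d / 2) => //; rewrite divr_gt0.
  move=> [z x] /= [z0z xd] w zw; have fz : `|f z0 - f z| < e / 2.
    by apply: fd; rewrite (lt_trans z0z)// ltr_pdivrMr// ltr_pMr// ltr1n.
  have fw : `|f z0 - f w| < e / 2.
    apply: fd; rewrite -(subrKA z) (le_lt_trans (le_normcD _ _))// [d]splitr.
    by rewrite ltrD// (lt_trans zw).
  rewrite -(subrKA (f z0)) [e]splitr (le_lt_trans (ler_normD _ _))// ltrD//.
  by rewrite distrC.
have /compact_near_coveringP/(_ _ _ _ _ (fun z0 _ => near_f z0)) cov := kf.
have [d [d0 fd]] := filter_ex (filterI (nbhs_right_gt (0 : R)) cov).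
exists d => // z w zw; have [zK|zK] := pselect (K z); first exact: fd.
have [wK|wK] := pselect (K w).
  by rewrite distrC; apply: (fd w wK); rewrite -normcN opprB.
by rewrite (eq0_off_support zK) (eq0_off_support wK) subrr normr0.
Qed.

End compact_support.

(** * Minimal polynomials of algebraic integers *)

Lemma irreducible_polyX (F : fieldType) : irreducible_poly ('X : {poly F}).
Proof. by rewrite -['X]subr0; exact: irredp_XsubC. Qed.

Lemma irreducible_root_dvdp (F L : fieldType) (f : {rmorphism F -> L})
    (p q : {poly F}) (x : L) :
  irreducible_poly p -> root (map_poly f p) x -> root (map_poly f q) x ->
  p %| q.
Proof.
move=> [_ ip] px qx; have [|/ip/(_ (dvdp_gcdl p q)) pE] := boolP (coprimep p q).
  by rewrite -(coprimep_map f) => /coprimep_root/(_ px)/negP[].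
by rewrite -(eqp_dvdl _ pE) dvdp_gcdr.
Qed.

Lemma dvdp_monic_rat_int (p : {poly rat}) (q : {poly int}) :
  p \is monic -> q \is monic -> p %| map_poly intr q ->
  exists p' : {poly int}, p = map_poly intr p'.
Proof.
move=> mp mq /dvdpP_rat_int[p1 [a a0 pE] [s qE]]; exists (lead_coef p1 *: p1).
have lead_unit : lead_coef p1 \is a GRing.unit.
  by apply/unitrPr; exists (lead_coef s); rewrite -lead_coefM -qE; exact/eqP.
have lead_sqr : (lead_coef p1)%:~R * (lead_coef p1)%:~R = 1 :> rat.
  by move: lead_unit; rewrite qualifE/= => /orP[] /eqP ->.
have lead_a : a * (lead_coef p1)%:~R = 1.
  move/eqP: mp; rewrite pE lead_coefZ lead_coef_map_inj//; exact: intr_inj.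
rewrite map_polyZ pE /=; congr (_ *: _).
by rewrite -{1}[a]mulr1 -{1}lead_sqr mulrA lead_a mul1r.
Qed.

Section conjugates.
Context {R : realType}.
Implicit Types (z : R[i]) (p : {poly rat}) (s : seq R[i]).

Local Notation QtoC := (map_poly (ratr : rat -> R[i])).
Local Notation ZtoC := (map_poly (intr : int -> R[i])).

Lemma map_poly_ratr_intr (q : {poly int}) : QtoC (map_poly intr q) = ZtoC q.
Proof.
by rewrite -map_poly_comp; apply: eq_map_poly => n; exact: rmorph_int.
Qed.

Lemma minpolyQ_unique z p :
  p \is monic -> irreducible_poly p -> root (QtoC p) z -> minpolyQ z = p.
Proof.
move=> mp ip pz; rewrite /minpolyQ; case: xgetP => [q _ [mq iq qz]|/(_ p)[]//].
apply/eqP; rewrite -eqp_monic//; apply/andP; split.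
  exact: irreducible_root_dvdp iq qz pz.
exact: irreducible_root_dvdp ip pz qz.
Qed.

Lemma minpolyQP z : algebraic_integer z ->
  [/\ minpolyQ z \is monic, irreducible_poly (minpolyQ z)
    & root (QtoC (minpolyQ z)) z].
Proof.
move=> [q mq qz]; have decQ : decidable_embedding (ratr : rat -> R[i]).
  by move=> w; exact: pselect.
have [|p [mp pz ip]] := minPoly_decidable_closure (x := z) decQ.
  by exists (map_poly intr q); rewrite ?monic_map// map_poly_ratr_intr.
by rewrite (minpolyQ_unique mp ip pz).
Qed.

Lemma minpolyQ_int z : algebraic_integer z ->
  exists q : {poly int}, minpolyQ z = map_poly intr q.
Proof.
move=> az; have [mp ip pz] := minpolyQP az; case: az => q mq qz.
apply: (dvdp_monic_rat_int mp mq); apply: (irreducible_root_dvdp ip pz).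
by rewrite map_poly_ratr_intr.
Qed.

Lemma prod_XsubC_galois_conjugates z : algebraic_integer z ->
  \prod_(b <- galois_conjugates z) ('X - b%:P) = QtoC (minpolyQ z).
Proof.
move=> /minpolyQP[mp _ _]; rewrite /galois_conjugates.
case: closed_field_poly_normal => /= s ->.
by rewrite lead_coef_map (eqP mp) rmorph1 scale1r.
Qed.

Lemma size_galois_conjugates z : algebraic_integer z ->
  size (galois_conjugates z) = algdegree z.
Proof.
move=> /prod_XsubC_galois_conjugates/(congr1 (size : {poly _} -> nat)).
by rewrite size_map_poly size_prod_XsubC /algdegree => <-.
Qed.

Lemma irreducible_galois_conjugates (q : {poly int}) s z :
  q \is monic -> irreducible_poly (map_poly (intr : int -> rat) q) ->
  ZtoC q = \prod_(b <- s) ('X - b%:P) -> z \in s ->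
  algebraic_integer z /\ perm_eq (galois_conjugates z) s.
Proof.
move=> mq iq qs sz; have qz : root (ZtoC q) z by rewrite qs root_prod_XsubC.
have az : algebraic_integer z by exists q.
split=> //; apply: prod_XsubC_eq; rewrite prod_XsubC_galois_conjugates// -qs.
by rewrite (minpolyQ_unique _ iq) ?map_poly_ratr_intr// monic_map.
Qed.

Lemma galois_conjugates0 :
  algebraic_integer (0 : R[i]) /\ galois_conjugates (0 : R[i]) = [:: 0].
Proof.
have [||||a0 /perm_small_eq gc0] := @irreducible_galois_conjugates 'X [:: 0] 0.
- exact: monicX.
- by rewrite map_polyX; exact: irreducible_polyX.
- by rewrite map_polyX big_seq1 subr0.
- exact: mem_head.
by split=> //; exact: gc0.
Qed.

Lemma minpolyQ_coef0_neq0 z : algebraic_integer z -> z != 0 ->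
  (minpolyQ z)`_0 != 0.
Proof.
move=> /minpolyQP[mp ip pz]; apply: contra_neq => p0.
have : root (QtoC (minpolyQ z)) 0.
  by rewrite rootE horner_coef0 coef_map/= p0 rmorph0.
move=> /(minpolyQ_unique mp ip) pE.
have X0 : root (QtoC 'X) 0 by rewrite map_polyX rootX.
have := minpolyQ_unique (monicX _) (@irreducible_polyX _) X0; rewrite pE => pX.
by move: pz; rewrite pX map_polyX rootX => /eqP.
Qed.

Lemma prod_normc_galois_conjugates_ge1 z : algebraic_integer z -> z != 0 ->
  1 <= \prod_(b <- galois_conjugates z) normc b.
Proof.
move=> az z0; have [q pq] := minpolyQ_int az.
have q0 : 1 <= `|q`_0|.
  have := minpolyQ_coef0_neq0 az z0; rewrite pq coef_map -gtz0_ge1 normr_gt0.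
  by apply: contraNneq => ->.
have /(congr1 (fun p : {poly R[i]} => `|p.[0]|)) :=
  prod_XsubC_galois_conjugates az.
rewrite horner_prod normr_prod pq map_poly_ratr_intr horner_coef0 coef_map/=.
under eq_bigr do rewrite hornerXsubC sub0r normrN normr_normc.
rewrite -rmorph_prod -intr_norm -(rmorph_int (real_complex R)) => /complexI ->.
by rewrite ler1z.
Qed.

End conjugates.

(** * Eisenstein polynomials with interlacing roots *)

Section eisenstein.
Variable p : nat.
Hypothesis prime_p : prime p.

Definition monic_eisenstein (q : {poly int}) :=
  [/\ q \is monic, (1 < size q)%N,
      forall i, (i < (size q).-1)%N -> (p %| q`_i)%Z
    & ~~ (p%:Z ^+ 2 %| q`_0)%Z].

Lemma monic_eisenstein_irreducible (q : {poly int}) :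
  monic_eisenstein q -> irreducible_poly (map_poly (intr : int -> rat) q).
Proof.
move=> [mq sq pq p2q].
apply/irreducible_rat_int/(eisenstein_crit prime_p) => //.
  by rewrite gtn_eqF.
by rewrite (eqP mq) dvdz1 neq_ltn prime_gt1 ?orbT.
Qed.

Lemma monic_eisenstein_comp_Xn (q : {poly int}) N : (0 < N)%N ->
  monic_eisenstein q -> monic_eisenstein (q \Po 'X^N).
Proof.
move=> N0 [mq sq pq p2q].
have size_Xn : (1 < size ('X^N : {poly int}))%N by rewrite size_polyXn ltnS.
have size_qX : (size (q \Po 'X^N)).-1 = ((size q).-1 * N)%N.
  by rewrite size_comp_poly size_polyXn.
have deg_q_gt0 : (0 < (size q).-1)%N by rewrite -subn1 subn_gt0.
split.
- by rewrite monicE lead_coef_comp// lead_coefXn expr1n mulr1 (eqP mq).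
- move: deg_q_gt0; rewrite -(ltn_pmul2r N0) mul0n -size_qX.
  by case: (size _) => [|[|]].
- move=> i; rewrite size_qX coef_comp_poly_Xn//; case: ifP => // _ iN.
  by apply: pq; rewrite ltn_divLR.
- by rewrite coef_comp_poly_Xn// dvdn0 div0n.
Qed.

End eisenstein.

Definition interlaces {R : realType} (m : nat) (t w : nat -> R) :=
  forall j, (j < m)%N -> t j < w j < t j.+1.

Section interlaces_theory.
Context {R : realType}.
Variables (m : nat) (t w : nat -> R).
Hypothesis tw : interlaces m t w.

Lemma interlaces_le i j : (i <= j <= m)%N -> t i <= t j.
Proof.
move=> /andP[+ jm]; elim: j jm => [|j ih] jm; first by rewrite leqn0 => /eqP->.
rewrite leq_eqVlt => /orP[/eqP->//|]; rewrite ltnS => ij.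
apply: le_trans (ih (ltnW jm) ij) _.
by have /andP[tj jt] := tw jm; rewrite ltW// (lt_trans tj).
Qed.

Lemma interlaces_lt_le i j : (i < j <= m)%N -> w i < t j.
Proof.
move=> /andP[ij jm]; have /andP[_ wi] := tw (leq_trans ij jm).
by rewrite (lt_le_trans wi)// interlaces_le// ij.
Qed.

Lemma interlaces_le_lt i j : (i <= j < m)%N -> t i < w j.
Proof.
move=> /andP[ij jm]; have /andP[wj _] := tw jm.
by rewrite (le_lt_trans _ wj)// interlaces_le// ij ltnW.
Qed.

Lemma interlaces_lt i j : (i < j < m)%N -> w i < w j.
Proof.
move=> /andP[ij jm].
rewrite (@lt_trans _ _ (t j)) ?interlaces_le_lt ?leqnn//.
by rewrite interlaces_lt_le// ij ltnW.
Qed.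

End interlaces_theory.

Definition alternating_poly {R : nzRingType} m (A : nat -> R) : {poly R} :=
  \poly_(i < m.+1) ((-1) ^+ (m - i) * A i).

Section alternating_poly_theory.
Context {R : nzRingType}.
Variables (m : nat) (A : nat -> R).
Hypothesis Am : A m = 1.

Lemma size_alternating_poly : size (alternating_poly m A) = m.+1.
Proof. by rewrite size_poly_eq// subnn expr0 mul1r Am oner_neq0. Qed.

Lemma monic_alternating_poly : alternating_poly m A \is monic.
Proof.
by rewrite monicE lead_coef_poly// subnn expr0 mul1r Am// oner_neq0.
Qed.

End alternating_poly_theory.

Lemma monic_eisenstein_alternating_poly (p m : nat) (c : nat -> int) :
  (0 < m)%N -> c m = 1 -> (forall i, (i < m)%N -> (p %| c i)%Z) ->
  ~~ (p%:Z ^+ 2 %| c 0%N)%Z ->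
  monic_eisenstein p (alternating_poly m c).
Proof.
move=> m0 cm pc p2c; split; rewrite ?size_alternating_poly//.
- exact: monic_alternating_poly.
- by move=> i im; rewrite coef_poly ltnS (ltnW im) dvdz_mull// pc.
- rewrite coef_poly/= subn0; apply: contra p2c => /(dvdz_mull ((-1) ^+ m)).
  by rewrite signrMK.
Qed.

Section dominant_coefficients.
Context {R : realType}.
Variables (m : nat) (A t : nat -> R).
Hypotheses (A_ge0 : forall i, (i <= m)%N -> 0 <= A i)
  (t_ge0 : forall j, (j <= m)%N -> 0 <= t j)
  (t_lt : forall j, (j < m)%N -> t j < t j.+1)
  (dominant : forall j : 'I_m.+1,
     \sum_(i < m.+1 | i != j) A i * t j ^+ i < A j * t j ^+ j).
Local Notation P := (alternating_poly m A).

Lemma alternating_poly_sign (j : 'I_m.+1) :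
  0 < (-1) ^+ (m - j) * P.[t j].
Proof.
rewrite horner_poly mulr_sumr (bigD1 j)//= !mulrA -expr2 sqrr_sign mul1r.
apply: (@lt_le_trans _ _ (A j * t j ^+ j
  - \sum_(i < m.+1 | i != j) A i * t j ^+ i)); first by rewrite subr_gt0.
rewrite lerD2l -sumrN ler_sum// => i _; rewrite lerNl.
apply: le_trans (ler_norm _) _; rewrite normrN !normrM !normr_sign !mul1r.
by rewrite !ger0_norm ?exprn_ge0 ?A_ge0 ?t_ge0// -ltnS.
Qed.

Lemma alternating_poly_root j : (j < m)%N ->
  exists2 x, t j < x < t j.+1 & root P x.
Proof.
move=> jm; have tj : t j <= t j.+1 by rewrite ltW ?t_lt.
have : P.[t j] * P.[t j.+1] < 0.
  have := mulr_gt0 (alternating_poly_sign (Ordinal (leqW jm)))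
    (alternating_poly_sign (Ordinal (jm : (j.+1 < m.+1)%N))).
  rewrite /= mulrACA -exprD -(subnSK jm) addSn exprS exprD -expr2 sqrr_sign.
  by rewrite mulr1 mulN1r oppr_gt0.
by move=> /(poly_ivtoo tj)[x]; rewrite in_itv/= => xj rx; exists x.
Qed.

Lemma alternating_poly_factor : A m = 1 -> exists2 w : nat -> R,
  interlaces m t w & P = \prod_(j < m) ('X - (w j)%:P).
Proof.
move=> Am; have /choice[w tw] : forall j, exists x,
    (j < m)%N -> t j < x < t j.+1 /\ root P x.
  move=> j; have [/alternating_poly_root[x]|] := ltnP j m; last by exists 0.
  by exists x.
have interlaced : interlaces m t w by move=> j /tw[].
exists w => //.
rewrite [LHS](@all_roots_prod_XsubC _ _ [seq w (val i) | i <- enum 'I_m]).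
- by rewrite (eqP (monic_alternating_poly Am)) scale1r big_map big_enum.
- by rewrite size_alternating_poly// size_map size_enum_ord.
- by apply/allP => _ /mapP[i _ ->]; have [] := tw i (ltn_ord i).
- rewrite uniq_rootsE map_inj_uniq ?enum_uniq// => i j wij; apply/val_inj => /=.
  have w_lt := interlaces_lt interlaced; have [ij|ji|//] := ltngtP i j.
    by have := w_lt i j; rewrite ij ltn_ord/= wij ltxx => /(_ isT).
  by have := w_lt j i; rewrite ji ltn_ord/= wij ltxx => /(_ isT).
Qed.

End dominant_coefficients.

Lemma near_ltr_expr {R : realType} (K a b : R) : 0 <= a < b ->
  \forall N \near \oo, K * a ^+ N < b ^+ N.
Proof.
move=> /andP[a0 ab]; have b0 := le_lt_trans a0 ab.
have : `|a / b| < 1.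
  by rewrite ger0_norm ?divr_ge0 ?(ltW b0)// ltr_pdivrMr ?mul1r.
move=> /(cvg_geometric K)/cvgr_lt/(_ 1 ltr01); apply: filterS => N /=.
by rewrite expr_div_n mulrA ltr_pdivrMr ?exprn_gt0// mul1r.
Qed.

Section interlacing_radii.
Context {R : realType}.
Variables (m : nat) (tau sigma : nat -> R).
Hypotheses (tau0 : tau 0%N = 0) (tau_sigma : interlaces m tau sigma)
  (prod_sigma_ge1 : 1 <= \prod_(0 <= j < m) sigma j).

Let tau_ge0 j : (j <= m)%N -> 0 <= tau j.
Proof. by move=> jm; rewrite -tau0 (interlaces_le tau_sigma). Qed.

Let sigma_gt0 j : (j < m)%N -> 0 < sigma j.
Proof. by move=> jm; rewrite -tau0 (interlaces_le_lt tau_sigma). Qed.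

Definition tail_prod j := \prod_(j <= k < m) sigma k.

Lemma tail_prod_cat i j : (i <= j <= m)%N ->
  tail_prod i = \prod_(i <= k < j) sigma k * tail_prod j.
Proof. by move=> /andP[ij jm]; rewrite /tail_prod (big_cat_nat ij jm). Qed.

Lemma tail_prod_gt0 j : 0 < tail_prod j.
Proof.
rewrite /tail_prod big_nat_cond; apply: prodr_gt0 => i /andP[/andP[_ im] _].
exact: sigma_gt0.
Qed.

(* [sigma] is increasing, so the tail product is bounded below by 1 or by the
   full product, according to whether [1 <= sigma j]. *)
Lemma tail_prod_ge1 j : (j <= m)%N -> 1 <= tail_prod j.
Proof.
have sigma_le i k : (i <= k < m)%N -> sigma i <= sigma k.
  rewrite leq_eqVlt => /andP[/orP[/eqP->//|ik] km].
  by rewrite ltW// (interlaces_lt tau_sigma)// ik.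
rewrite leq_eqVlt => /orP[/eqP->|jm]; first by rewrite /tail_prod big_geq.
have [sj|sj] := leP 1 (sigma j).
  rewrite /tail_prod big_nat_cond; apply: (big_ind (fun x => 1 <= x)) => //.
    by move=> x y x1 y1; rewrite -[1]mulr1 ler_pM.
  by move=> i; rewrite andbT => ijm; rewrite (le_trans sj)// sigma_le.
rewrite (le_trans prod_sigma_ge1)// -/(tail_prod 0).
rewrite (@tail_prod_cat 0 j) ?(ltnW jm)// ler_piMl ?(ltW (tail_prod_gt0 j))//.
rewrite big_nat_cond; apply: prodr_ile1 => i; rewrite andbT => /andP[_ ij].
rewrite ltW ?sigma_gt0 ?(ltn_trans ij)//=.
by rewrite (le_trans _ (ltW sj))// sigma_le// (ltnW ij).
Qed.

Lemma prod_sigma_lt i j : (i < j <= m)%N ->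
  \prod_(i <= k < j) sigma k < tau j ^+ (j - i).
Proof.
move=> /andP[ij jm]; rewrite -prodr_const_nat.
apply: ltr_prod_nat => // k /andP[_ kj].
by rewrite ltW ?sigma_gt0 ?(leq_trans kj)//= (interlaces_lt_le tau_sigma)// kj.
Qed.

Lemma lt_prod_sigma i j : (j < i <= m)%N ->
  tau j ^+ (i - j) < \prod_(j <= k < i) sigma k.
Proof.
move=> /andP[ji im]; rewrite -prodr_const_nat.
apply: ltr_prod_nat => // k /andP[jk ki].
have km := leq_trans ki im; rewrite tau_ge0 ?(leq_trans jk (ltnW km))//=.
by rewrite (interlaces_le_lt tau_sigma)// jk.
Qed.

Let tau_gt0 j : (0 < j <= m)%N -> 0 < tau j.
Proof.
move=> jm; have [j0 j1] := andP jm.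
rewrite (lt_trans (sigma_gt0 (leq_trans j0 j1)))//.
by rewrite (interlaces_lt_le tau_sigma).
Qed.

Let tau_exprn_gt0 j : (j <= m)%N -> 0 < tau j ^+ j.
Proof.
by move=> jm; have [->//|j0] := posnP j; rewrite exprn_gt0// tau_gt0// j0.
Qed.

Lemma tail_prod_dominant i j : (i <= m)%N -> (j <= m)%N -> i != j ->
  tail_prod i * tau j ^+ i < tail_prod j * tau j ^+ j.
Proof.
move=> im jm; rewrite neq_ltn => /orP[ij|ji].
- have tauj : 0 < tau j by rewrite tau_gt0// (leq_ltn_trans (leq0n i) ij).
  have -> : tau j ^+ j = tau j ^+ (j - i) * tau j ^+ i.
    by rewrite -exprD subnK// ltnW.
  rewrite (@tail_prod_cat i j) ?(ltnW ij)// mulrA ltr_pM2r ?exprn_gt0// mulrC.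
  by rewrite ltr_pM2l ?tail_prod_gt0// prod_sigma_lt// ij.
- have -> : tau j ^+ i = tau j ^+ (i - j) * tau j ^+ j.
    by rewrite -exprD subnK// ltnW.
  rewrite (@tail_prod_cat j i) ?(ltnW ji)// mulrA ltr_pM2r ?tau_exprn_gt0//.
  by rewrite [ltRHS]mulrC ltr_pM2l ?tail_prod_gt0// lt_prod_sigma// ji.
Qed.

Lemma near_dominant (K : R) : \forall N \near \oo, forall A : nat -> R,
  (forall i, (i <= m)%N -> tail_prod i ^+ N <= A i <= K * tail_prod i ^+ N) ->
  forall j : 'I_m.+1,
  \sum_(i < m.+1 | i != j) A i * (tau j ^+ N) ^+ i < A j * (tau j ^+ N) ^+ j.
Proof.
pose b i j : R := tail_prod i * tau j ^+ i.
have near_b : \forall N \near \oo, forall ij : 'I_m.+1 * 'I_m.+1,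
    ij.1 != ij.2 -> m.+1%:R * K * b ij.1 ij.2 ^+ N < b ij.2 ij.2 ^+ N.
  apply: filter_forall => -[i j] /=.
  have [->|ij] := eqVneq i j; first exact: nearW.
  apply: filterS (near_ltr_expr (m.+1%:R * K) _) => [N + _|]; first exact.
  have im : (i <= m)%N := ltn_ord i; have jm : (j <= m)%N := ltn_ord j.
  rewrite tail_prod_dominant// mulr_ge0 ?(ltW (tail_prod_gt0 i))//.
  by rewrite exprn_ge0// tau_ge0.
apply: filterS near_b => N bN A AK j; have jm : (j <= m)%N := ltn_ord j.
have bE i : b i j ^+ N = tail_prod i ^+ N * (tau j ^+ N) ^+ i.
  by rewrite exprMn -!exprM mulnC.
have tau_ge0N i : 0 <= (tau j ^+ N) ^+ i by rewrite !exprn_ge0// tau_ge0.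
have b_gt0 : 0 < b j j ^+ N.
  by rewrite exprn_gt0// mulr_gt0 ?tail_prod_gt0 ?tau_exprn_gt0.
apply: (@lt_le_trans _ _ (b j j ^+ N)); last first.
  by rewrite bE ler_wpM2r//; case/andP: (AK j jm).
apply: (@le_lt_trans _ _ (\sum_(i < m.+1 | i != j) m.+1%:R^-1 * b j j ^+ N)).
  apply: ler_sum => i ij; rewrite ler_pdivlMl//.
  apply: le_trans (ltW (bN (i, j) ij)); rewrite -mulrA ler_pM2l//= bE mulrA.
  by rewrite ler_wpM2r//; case/andP: (AK i (ltn_ord i : (i <= m)%N)).
rewrite sumr_const cardC1 card_ord/= -[ltLHS]mulr_natl mulrA gtr_pMl//.
by rewrite ltr_pdivrMr// mul1r ltr_nat.
Qed.

Lemma exists_twice_odd (x : R) : 1 <= x -> exists a : int,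
  [/\ (2 %| a)%Z, ~~ (2%:Z ^+ 2 %| a)%Z & x <= a%:~R <= 6 * x].
Proof.
move=> x1; have := floor_le x; have := floorD1_gt x.
move: (Num.floor x) => k; rewrite intrD => xk kx.
exists (2 * (2 * k + 1)); split; first exact: dvdz_mulr.
  by apply/negP => /dvdzP[l]; rewrite expr2; lia.
by rewrite !(intrM, intrD); apply/andP; split; lra.
Qed.

Lemma exists_eisenstein_coefs N : exists c : nat -> int, [/\ c m = 1,
    forall i, (i < m)%N -> (2 %| c i)%Z && ~~ (2%:Z ^+ 2 %| c i)%Z
  & forall i, (i <= m)%N ->
      tail_prod i ^+ N <= (c i)%:~R <= 6 * tail_prod i ^+ N].
Proof.
have /choice[a aP] : forall i, exists a : int, (i < m)%N ->
    [/\ (2 %| a)%Z, ~~ (2%:Z ^+ 2 %| a)%Z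
      & tail_prod i ^+ N <= a%:~R <= 6 * tail_prod i ^+ N].
  move=> i; have [/ltnW im|] := ltnP i m; last by exists 0.
  by have [a] := exists_twice_odd (exprn_ege1 N (tail_prod_ge1 im)); exists a.
exists (fun i => if (i < m)%N then a i else 1); split; first by rewrite ltnn.
  by move=> i im; rewrite im; have [-> ->] := aP i im.
move=> i; rewrite leq_eqVlt => /orP[/eqP->|im].
  by rewrite ltnn /tail_prod big_geq// expr1n; apply/andP; split; lra.
by rewrite im; have [] := aP i im.
Qed.

Lemma near_eisenstein_interlaced_roots : (0 < m)%N -> \forall N \near \oo,
  exists2 q : {poly int}, monic_eisenstein 2 q
  & exists2 w : nat -> R, interlaces m (fun j => tau j ^+ N) w
  & map_poly intr q = \prod_(j < m) ('X - (w j)%:P).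
Proof.
move=> m0; apply: filterS2 (nbhs_infty_gt 0) (near_dominant 6) => N N0 dominant.
have [c [cm c2 c_bound]] := exists_eisenstein_coefs N.
exists (alternating_poly m c).
  apply: monic_eisenstein_alternating_poly => // [i im|].
    by have /andP[] := c2 i im.
  by have /andP[] := c2 0%N m0.
have [||j jm|||w tw qE] := @alternating_poly_factor R m (fun i => (c i)%:~R)
    (fun j => tau j ^+ N).
- move=> i /c_bound/andP[+ _]; apply: le_trans.
  by rewrite exprn_ge0 ?(ltW (tail_prod_gt0 _)).
- by move=> j jm; rewrite exprn_ge0// tau_ge0.
- rewrite ltrXn2r -?lt0n ?tau_ge0//; first exact: ltnW.
  by have /andP[tj jt] := tau_sigma jm; exact: lt_trans tj jt.
- exact: dominant c_bound.
- by rewrite cm.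
exists w => //; rewrite -qE.
apply/polyP => i; rewrite coef_map/= !coef_poly; case: ifP => // _.
by rewrite intrM; congr (_ * _); exact: rmorph_sign.
Qed.

End interlacing_radii.

(** * Radii of annuli of equal mass *)

Section factorial_bounds.
Context {R : realType}.

Lemma exprn_lt_expR_fact n : (0 < n)%N -> n%:R ^+ n < expR n%:R * n`!%:R :> R.
Proof.
have fact0 : 0 < n`!%:R :> R by rewrite ltr0n fact_gt0.
case: n fact0 => [//|n] fact0 _.
by rewrite -ltr_pdivrMr// (lt_le_trans _ (expR_ge1Dxn n _))// ltrDr.
Qed.

Lemma expR1_le_exprn n : (0 < n)%N -> expR 1 <= (n.+1%:R / n%:R) ^+ n.+1 :> R.
Proof.
move=> n0; have -> : expR 1 = expR n.+1%:R^-1 ^+ n.+1 :> R.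
  by rewrite -expRM_natl mulfV.
rewrite lerXn2r ?nnegrE ?expR_ge0 ?divr_ge0//.
rewrite -[X in expR X]opprK expRN -[leRHS]invf_div.
rewrite lef_pV2 ?posrE ?expR_gt0 ?divr_gt0 ?ltr0n//.
have -> : n%:R / n.+1%:R = 1 - n.+1%:R^-1 :> R; last exact: expR_ge1Dx.
by rewrite -natr1; field; rewrite natr1.
Qed.

Lemma fact_expR_le n : (0 < n)%N ->
  n`!%:R * expR n%:R <= expR 1 * n%:R * n%:R ^+ n :> R.
Proof.
elim: n => // -[_ _|n ih _]; first by rewrite -[1`!]/1%N expr1 mul1r !mulr1.
have -> : n.+2`!%:R * expR n.+2%:R =
    n.+1`!%:R * expR n.+1%:R * (n.+2%:R * expR 1) :> R.
  by rewrite factS natrM -[X in expR X]natr1 expRD [X in X * _]mulrC mulrACA.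
have -> : expR 1 * n.+2%:R * n.+2%:R ^+ n.+2 =
    expR 1 * n.+1%:R * n.+1%:R ^+ n.+1 *
    (n.+2%:R * (n.+2%:R / n.+1%:R) ^+ n.+2) :> R.
  by rewrite expr_div_n !exprS; field; rewrite nat1r expf_neq0 ?pnatr_eq0.
by rewrite ler_pM ?ih ?mulr_ge0 ?expR_ge0// ler_pM2l// expR1_le_exprn.
Qed.

Lemma exists_exprn_fact_lt (s : R) : 0 < s < expR 1 ->
  exists2 n, (0 < n)%N & s ^+ n * n`!%:R < n%:R ^+ n.
Proof.
move=> /andP[s0 se]; pose d : R := 1 - ln s.
have d0 : 0 < d by rewrite subr_gt0 -ltr_expR lnK.
pose n := (Num.truncn (expR 1 * 2 / d ^+ 2)).+1; exists n => //.
have n_gt : expR 1 * 2 < n%:R * d ^+ 2.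
  by rewrite -ltr_pdivrMr ?exprn_gt0//; exact: truncnS_gt.
have expR_nd : expR 1 * n%:R < expR (n%:R * d).
  apply: lt_le_trans (expR_ge1Dxn 1 _); last by rewrite mulr_ge0// ltW.
  have : expR 1 * 2 * n%:R < n%:R * d ^+ 2 * n%:R by rewrite ltr_pM2r.
  by rewrite -[2`!]/2%N exprMn; lra.
have s_expR : s ^+ n * expR (n%:R * d) = expR n%:R.
  rewrite -[s in LHS]lnK ?posrE// -expRM_natl -expRD; congr expR.
  by rewrite /d; ring.
rewrite -(ltr_pM2r (expR_gt0 (n%:R * d))) mulrAC s_expR mulrC.
apply: le_lt_trans (fact_expR_le _) _ => //.
by rewrite [ltRHS]mulrC ltr_pM2r// exprn_gt0.
Qed.

Lemma sqr_expR_half : expR (1 / 2) ^+ 2 = expR 1 :> R.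
Proof. by rewrite -expRM_natl; congr expR; lra. Qed.

End factorial_bounds.

Section annulus_radius.
Context {R : realType}.
Implicit Types (r : R) (m i j : nat).

Definition annulus_radius r m j : R := r * Num.sqrt (j%:R / m%:R).

Lemma annulus_radius0 r m : annulus_radius r m 0 = 0.
Proof. by rewrite /annulus_radius mul0r sqrtr0 mulr0. Qed.

Lemma annulus_radius_last r m : (0 < m)%N -> annulus_radius r m m = r.
Proof.
by move=> m0; rewrite /annulus_radius divff ?sqrtr1 ?mulr1// pnatr_eq0 -lt0n.
Qed.

Lemma sqr_annulus_radius r m j :
  annulus_radius r m j ^+ 2 = r ^+ 2 * (j%:R / m%:R).
Proof. by rewrite exprMn sqr_sqrtr. Qed.

Lemma prod_sqr_annulus_radius r m :
  (\prod_(j < m) annulus_radius r m j.+1) ^+ 2 =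
  (r ^+ 2) ^+ m * m`!%:R / m%:R ^+ m.
Proof.
rewrite -prodrXl; under eq_bigr do rewrite sqr_annulus_radius.
rewrite big_split/= prodr_const card_ord big_split/= prodr_const card_ord.
by rewrite exprVn mulrA fact_prod big_add1/= big_mkord natr_prod.
Qed.

Variables (r : R) (m : nat).
Hypotheses (r0 : 0 < r) (m0 : (0 < m)%N).

Let m_gt0 : 0 < m%:R :> R.
Proof. by rewrite ltr0n. Qed.

Lemma annulus_radius_ge0 j : 0 <= annulus_radius r m j.
Proof. by rewrite mulr_ge0// ltW. Qed.

Lemma ltr_annulus_radius i j :
  (annulus_radius r m i < annulus_radius r m j) = (i < j)%N.
Proof.
rewrite -(@ltr_pXn2r _ 2%N) ?nnegrE ?annulus_radius_ge0// !sqr_annulus_radius.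
by rewrite ltr_pM2l ?exprn_gt0// ltr_pM2r ?invr_gt0// ltr_nat.
Qed.

Lemma ler_annulus_radius i j :
  (annulus_radius r m i <= annulus_radius r m j) = (i <= j)%N.
Proof. by rewrite leNgt ltr_annulus_radius -leqNgt. Qed.

Lemma annulus_radius_gt0 j : (0 < j)%N -> 0 < annulus_radius r m j.
Proof. by rewrite -(annulus_radius0 r m) ltr_annulus_radius. Qed.

Lemma annulus_radius_le j : (j <= m)%N -> annulus_radius r m j <= r.
Proof. by rewrite -[in leRHS](annulus_radius_last r m0) ler_annulus_radius. Qed.

Lemma annulus_width_le j :
  annulus_radius r m j.+1 - annulus_radius r m j <= r / Num.sqrt m%:R.
Proof.
rewrite /annulus_radius -mulrBr ler_pM2l// lerBlDr -sqrtrV ?(ltW m_gt0)//.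
rewrite -(@ler_pXn2r _ 2%N) ?nnegrE ?addr_ge0 ?sqrtr_ge0//.
rewrite sqrrD !sqr_sqrtr ?divr_ge0 ?invr_ge0//.
have := mulr_ge0 (sqrtr_ge0 (m%:R^-1 : R)) (sqrtr_ge0 (j%:R / m%:R)).
rewrite -natr1 mulrDl mul1r -mulr_natl; lra.
Qed.

Lemma prod_annulus_radius_gt1 : expR (1 / 2) <= r ->
  1 < \prod_(j < m) annulus_radius r m j.+1.
Proof.
move=> er; rewrite -(@ltr_pXn2r _ 2%N)// ?nnegrE//; last first.
  by apply: prodr_ge0 => j _; exact: annulus_radius_ge0.
rewrite expr1n prod_sqr_annulus_radius ltr_pdivlMr ?exprn_gt0// mul1r.
apply: lt_le_trans (exprn_lt_expR_fact m0) _.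
rewrite ler_pM2r ?ltr0n ?fact_gt0// -[X in expR X]mulr1 expRM_natl.
by rewrite -sqr_expR_half !lerXn2r ?nnegrE ?exprn_ge0 ?expR_ge0 ?(ltW r0).
Qed.

(* The outer radii scaled by a factor just below 1 *)
Lemma exists_interlaced_annulus_radius : expR (1 / 2) <= r ->
  exists2 sigma, interlaces m (annulus_radius r m) sigma
    & 1 <= \prod_(0 <= j < m) sigma j.
Proof.
move=> er; set t := annulus_radius r m; set Q := \prod_(j < m) t j.+1.
have near_prod : \forall c \near (1 : R)^'-, 1 < c ^+ m * Q.
  apply: (@cvgr_gt _ _ _ _ (fun c => c ^+ m * Q) (1 ^+ m * Q)).
    apply: cvg_at_left_filter; apply: cvgM; last exact: cvg_cst.
    exact: exprn_continuous.
  by rewrite expr1n mul1r; exact: prod_annulus_radius_gt1.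
have near_radius :
    \forall c \near (1 : R)^'-, forall j : 'I_m, t j < c * t j.+1.
  apply: filter_forall => j.
  apply: (@cvgr_gt _ _ _ _ (fun c => c * t j.+1) (1 * t j.+1)).
    by apply: cvg_at_left_filter; apply: cvgM; [exact: cvg_id|exact: cvg_cst].
  by rewrite mul1r ltr_annulus_radius.
have near_lt1 : \forall c \near (1 : R)^'-, c < 1 by exact: nbhs_left_lt.
have [c [c1 [cQ ct]]] :=
  filter_ex (filterI near_lt1 (filterI near_prod near_radius)).
exists (fun j => c * t j.+1) => [j jm|].
  by rewrite (ct (Ordinal jm))/= gtr_pMl// annulus_radius_gt0.
by rewrite big_mkord big_split/= prodr_const card_ord ltW.
Qed.

End annulus_radius.

Lemma near_annulus_width_lt {R : realType} (r d : R) : 0 < r -> 0 < d ->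
  \forall m \near \oo, r / Num.sqrt m%:R < d.
Proof.
move=> r0 d0; near=> m; have m0 : 0 < m%:R :> R.
  by rewrite ltr0n; near: m; exact: nbhs_infty_gt.
rewrite ltr_pdivrMr ?sqrtr_gt0// -ltr_pdivrMl//.
rewrite -[ltLHS]gtr0_norm ?mulr_gt0 ?invr_gt0// -sqrtr_sqr ltr_sqrt//.
by near: m; exact: nbhs_infty_gtr.
Unshelve. all: by end_near. Qed.

Lemma exists_prod_annulus_radius_lt1 {R : realType} (r : R) :
  0 < r < expR (1 / 2) ->
  exists2 m, (0 < m)%N & \prod_(j < m) annulus_radius r m j.+1 < 1.
Proof.
move=> /andP[r0 re]; have sqr_r : 0 < r ^+ 2 < expR 1.
  by rewrite exprn_gt0//= -sqr_expR_half ltr_pXn2r ?nnegrE ?expR_ge0 ?(ltW r0).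
have [m m0 mP] := exists_exprn_fact_lt sqr_r; exists m => //.
rewrite -(@ltr_pXn2r _ 2%N)// ?nnegrE//; last first.
  by apply: prodr_ge0 => j _; exact: annulus_radius_ge0.
by rewrite expr1n prod_sqr_annulus_radius ltr_pdivrMr ?exprn_gt0 ?ltr0n// mul1r.
Qed.

(** * Roots of unity *)

Section cis.
Context {R : realType}.
Implicit Types (a b : R) (z : R[i]).

Definition cis a : R[i] := cos a +i* sin a.

Lemma cis0 : cis 0 = 1. Proof. by rewrite /cis cos0 sin0. Qed.

Lemma cis2pi : cis (pi *+ 2) = 1. Proof. by rewrite /cis cos2pi sin2pi. Qed.

Lemma cisD a b : cis (a + b) = cis a * cis b.
Proof. by rewrite /cis cosD sinD; simpc; congr (_ +i* _); ring. Qed.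

Lemma cisX a n : cis a ^+ n = cis (a *+ n).
Proof. by elim: n => [|n ih]; rewrite ?mulr0n ?cis0// exprS ih -cisD mulrS. Qed.

Lemma normc_cis a : normc (cis a) = 1.
Proof. by rewrite /= cos2Dsin2 sqrtr1. Qed.

Lemma cis_neq1 a : 0 < a < pi *+ 2 -> cis a != 1.
Proof.
move=> /andP[a0 a2]; apply/eqP => -[+ _].
have s0 : 0 < sin (a / 2) by apply: sin_gt0_pi; lra.
rewrite [a]splitr cosD; have := cos2Dsin2 (a / 2); nra.
Qed.

Lemma near_cis (e : R) : 0 < e -> \forall a \near 0, normc (cis a - 1) < e.
Proof.
move=> e0; have e2_gt0 : 0 < e / 2 by rewrite divr_gt0.
have /cvgrPdist_lt/(_ _ e2_gt0) := @continuous_cos R 0.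
have /cvgrPdist_lt/(_ _ e2_gt0) := @continuous_sin R 0.
apply: filterS2 => a; rewrite sin0 cos0 sub0r normrN => sina cosa.
rewrite (_ : cis a - 1 = (cos a - 1) +i* sin a); last first.
  by apply/eqP; rewrite eq_complex/= subr0 !eqxx.
rewrite (le_lt_trans (ler_normc_ReIm _ _))// [e]splitr ltrD//.
by rewrite distrC.
Qed.

Lemma polar z : exists2 a : R, - pi <= a <= pi & z = (normc z)%:C * cis a.
Proof.
have [->|z0] := eqVneq z 0.
  by exists 0; [have := pi_ge0 R; lra|rewrite normc0 mul0r].
case: z z0 => x y z0; set n := normc _.
have n0 : 0 < n.
  rewrite lt_neqAle normc_ge0 andbT eq_sym.
  by apply: contra_neq z0; exact: eq0_normc.
have nE : n ^+ 2 = x ^+ 2 + y ^+ 2 by rewrite sqr_sqrtr// addr_ge0 ?sqr_ge0.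
have xn : -1 <= x / n <= 1.
  rewrite -ler_norml normrM normfV (gtr0_norm n0) ler_pdivrMr// mul1r.
  exact: ler_Re_normc.
have [/andP[a0 api] cosa] := acos_def xn.
have sina : sin (acos (x / n)) = `|y / n|.
  rewrite sin_acos// -sqrtr_sqr; congr Num.sqrt.
  apply: (mulIf (_ : n ^+ 2 != 0)); first by rewrite expf_neq0 ?gt_eqF.
  by rewrite mulrBl -!exprMn !divfK ?gt_eqF// mul1r nE; ring.
have [y0|y0] := leP 0 y.
  exists (acos (x / n)); first by rewrite api andbT; lra.
  rewrite /cis cosa sina ger0_norm ?divr_ge0 ?(ltW n0)//; simpc.
  by rewrite ![n * _]mulrC !divfK ?gt_eqF.
exists (- acos (x / n)); first lra.
rewrite /cis cosN sinN cosa sina normrM (ltr0_norm y0) normfV (gtr0_norm n0).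
by rewrite mulNr opprK; simpc; rewrite ![n * _]mulrC !divfK ?gt_eqF.
Qed.

End cis.

Section unit_root.
Context {R : realType}.
Implicit Types (N : nat) (z : R[i]).

Let pi2_gt0 : 0 < pi *+ 2 :> R.
Proof. by rewrite pmulrn_lgt0// pi_gt0. Qed.

Definition unit_root N : R[i] := cis (pi *+ 2 / N%:R).

Lemma normc_unit_root N : normc (unit_root N) = 1.
Proof. exact: normc_cis. Qed.

Lemma unit_root_prim N : (0 < N)%N -> N.-primitive_root (unit_root N).
Proof.
move=> N0; rewrite /primitive_root_of_unity N0/=; apply/forallP => i; apply/eqP.
have NR_gt0 : 0 < N%:R :> R by rewrite ltr0n.
rewrite unity_rootE cisX -[_ *+ i.+1]mulr_natl; have [iN|iN] := eqVneq i.+1 N.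
  by rewrite iN mulrC divfK ?(gt_eqF NR_gt0)// cis2pi eqxx.
apply/negbTE/cis_neq1; rewrite mulrA ltr_pdivrMr//.
rewrite divr_gt0 ?mulr_gt0 ?pi2_gt0//= mulrC ltr_pM2l ?pi2_gt0// ltr_nat.
by rewrite ltn_neqAle iN ltn_ord.
Qed.

(* The multiple of [2 pi / N] nearest to [- arg z] from below, modulo [2 pi] *)
Lemma near_rotate_real (e : R) : 0 < e ->
  \forall N \near \oo, forall z, exists l,
  normc (unit_root N ^+ l * z - (normc z)%:C) <= e * normc z.
Proof.
move=> e0; have /nbhs_ballP[d /= d0 cis_d] := near_cis e0.
near=> N => z; pose delta : R := pi *+ 2 / N%:R.
have N0 : 0 < N%:R :> R by rewrite ltr0n; near: N; exact: nbhs_infty_gt.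
have delta0 : 0 < delta by rewrite divr_gt0// pi2_gt0.
have delta_d : delta < d.
  by rewrite ltr_pdivrMr// -ltr_pdivrMl//; near: N; exact: nbhs_infty_gtr.
have [a /andP[_ a_pi] zE] := polar z.
have /truncn_itv : 0 <= (pi *+ 2 - a) / delta.
  rewrite divr_ge0 ?(ltW delta0)// subr_ge0 (le_trans a_pi)//.
  by rewrite mulr2n lerDl pi_ge0.
set l := Num.truncn _; rewrite ler_pdivlMr// ltr_pdivrMr// -natr1 mulrDl mul1r.
move=> /andP[l_le l_gt]; exists l; pose b := delta *+ l + a - pi *+ 2.
have -> : unit_root N ^+ l * z = (normc z)%:C * cis b.
  rewrite {1}zE mulrCA cisX -cisD -[in LHS](subrK (pi *+ 2) (_ + a)).
  by rewrite [in LHS]cisD cis2pi mulr1.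
rewrite -{2}[(normc z)%:C]mulr1 -mulrBr normcM normc_real.
rewrite ger0_norm ?normc_ge0// mulrC ler_wpM2r ?normc_ge0// ltW// cis_d//.
rewrite /ball/= sub0r normrN (le_lt_trans _ delta_d)// ler_norml /b -mulr_natl.
by apply/andP; split; lra.
Unshelve. all: by end_near. Qed.

End unit_root.

Lemma XnsubC_prim_root (F : fieldType) n (x a : F) : n.-primitive_root x ->
  'X^n - (a ^+ n)%:P = \prod_(0 <= k < n) ('X - (a * x ^+ k)%:P).
Proof.
move=> xn; have n0 := prim_order_gt0 xn; have [->|a0] := eqVneq a 0.
  under eq_bigr do rewrite mul0r subr0.
  by rewrite prodr_const_nat subn0 expr0n gtn_eqF// subr0.
rewrite [LHS](@all_roots_prod_XsubC _ _ [seq a * x ^+ k | k <- index_iota 0 n]).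
- by rewrite (eqP (monicXnsubC _ _))// scale1r big_map.
- by rewrite size_XnsubC// size_map size_iota subn0.
- apply/allP => _ /mapP[k _ ->].
  rewrite rootE !hornerE exprMn exprAC (prim_expr_order xn).
  by rewrite expr1n mulr1 subrr.
- rewrite uniq_rootsE map_inj_in_uniq ?iota_uniq// => i j.
  rewrite !mem_index_iota => /= i_n j_n /(mulfI a0)/eqP.
  by rewrite (eq_prim_root_expr xn) !modn_small// => /eqP.
Qed.

(** * Conjugates on circles *)

Section circle_points.
Context {R : realType}.
Implicit Types (rho : nat -> R) (m N : nat).

Definition circle_points m N rho : seq R[i] :=
  [seq (rho j)%:C * unit_root N ^+ k
     | j <- index_iota 0 m, k <- index_iota 0 N].

Lemma prod_XsubC_circle_points m N rho : (0 < N)%N ->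
  \prod_(b <- circle_points m N rho) ('X - b%:P) =
  map_poly (real_complex R) (\prod_(j < m) ('X - (rho j ^+ N)%:P)) \Po 'X^N.
Proof.
move=> N0; rewrite big_allpairs_dep/= big_mkord 2!rmorph_prod/=.
apply: eq_bigr => j _; rewrite -(XnsubC_prim_root _ (unit_root_prim N0)).
rewrite map_polyXsubC rmorphB/= comp_polyX comp_polyC.
by rewrite (rmorphXn (real_complex R)).
Qed.

Lemma normc_circle_points m N rho b : b \in circle_points m N rho ->
  exists2 j, (j < m)%N & normc b = `|rho j|.
Proof.
move=> /allpairsP[[j k] [/= jm _ ->]].
exists j; first by rewrite mem_index_iota in jm.
by rewrite normcM normcX normc_unit_root expr1n mulr1 normc_real.
Qed.

Lemma near_conjugates_on_circles (r : R) m : expR (1 / 2) <= r -> (0 < m)%N ->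
  \forall N \near \oo, exists z rho, [/\ algebraic_integer z,
    interlaces m (annulus_radius r m) rho
  & perm_eq (galois_conjugates z) (circle_points m N rho)].
Proof.
move=> er m0; have r0 : 0 < r := lt_le_trans (expR_gt0 _) er.
have [sigma tau_sigma prod_sigma] := exists_interlaced_annulus_radius r0 m0 er.
apply: filterS2 (nbhs_infty_gt 0)
  (near_eisenstein_interlaced_roots (annulus_radius0 r m) tau_sigma
     prod_sigma m0).
move=> N N0 [q eisenstein_q [w tau_w qw]]; pose rho j := w j `^ N%:R^-1.
have w_ge0 j : (j < m)%N -> 0 <= w j.
  move=> /tau_w/andP[/ltW + _]; apply: le_trans.
  by rewrite exprn_ge0 ?annulus_radius_ge0.
have rhoX j : (j < m)%N -> rho j ^+ N = w j.
  move=> jm; rewrite -powR_mulrn ?powR_ge0// -powRrM mulVf ?pnatr_eq0 -?lt0n//.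
  by rewrite powRr1// w_ge0.
have qX : map_poly (intr : int -> R[i]) (q \Po 'X^N) =
    \prod_(b <- circle_points m N rho) ('X - b%:P).
  rewrite prod_XsubC_circle_points//.
  under eq_bigr => j _ do rewrite rhoX//.
  rewrite -qw map_comp_poly map_polyXn -map_poly_comp; congr (_ \Po _).
  by apply: eq_map_poly => n; rewrite /= rmorph_int.
have eisenstein_qX := monic_eisenstein_comp_Xn N0 eisenstein_q.
have [monic_qX _ _ _] := eisenstein_qX.
have irreducible_qX :=
  monic_eisenstein_irreducible (isT : prime 2) eisenstein_qX.
have rho0_in : (rho 0%N)%:C \in circle_points m N rho.
  apply/allpairsP; exists (0%N, 0%N) => /=.
  by rewrite !mem_index_iota/= expr0 mulr1.
have [az gc] :=
  irreducible_galois_conjugates monic_qX irreducible_qX qX rho0_in.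
exists (rho 0%N)%:C, rho; split=> // j jm; have := tau_w j jm.
by rewrite -(rhoX j jm) !ltr_pXn2r ?nnegrE ?annulus_radius_ge0 ?powR_ge0.
Qed.

End circle_points.

(** * Rotation invariance of area *)

Lemma measurable_preimageT d d' (S : measurableType d) (T : measurableType d')
    (f : S -> T) (A : set T) :
  measurable_fun setT f -> measurable A -> measurable (f @^-1` A).
Proof. by move=> mf mA; rewrite -[X in measurable X]setTI; exact: mf. Qed.

Section measure_preserving.
Context {R : realType}.

Definition measure_preserving d (T : measurableType d) (mu : set T -> \bar R)
    (f : T -> T) :=
  measurable_fun setT f /\ forall A, measurable A -> mu (f @^-1` A) = mu A.

Lemma measure_preserving_comp d (T : measurableType d) (mu : set T -> \bar R)
    (f g : T -> T) :
  measure_preserving mu f -> measure_preserving mu g ->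
  measure_preserving mu (f \o g).
Proof.
move=> [mf fmu] [mg gmu]; split=> [|A mA]; first exact: measurableT_comp.
by rewrite comp_preimage gmu ?fmu//; exact: measurable_preimageT.
Qed.

Lemma measure_preserving_pushforward d d' (S : measurableType d)
    (T : measurableType d') (mu : set S -> \bar R)
    (phi : S -> T) (f : S -> S) (g : T -> T) :
  measurable_fun setT phi -> measurable_fun setT g -> g \o phi = phi \o f ->
  measure_preserving mu f -> measure_preserving (pushforward mu phi) g.
Proof.
move=> mphi mg gphi [_ fmu]; split=> // A mA.
rewrite /pushforward -comp_preimage gphi comp_preimage fmu//.
exact: measurable_preimageT.
Qed.

Lemma Rintegral_measure_preserving d (T : measurableType d)
    (mu : {measure set T -> \bar R}) (f : T -> T) (g : T -> R) :
  measure_preserving mu f -> measurable_fun setT g ->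
  mu.-integrable setT (EFin \o (g \o f)) ->
  \int[mu]_x g (f x) = \int[mu]_x g x.
Proof.
move=> [mf fmu] mg ifg; have mEg : measurable_fun setT (EFin \o g).
  exact/measurable_EFinP.
congr fine; have := integral_pushforward mf mEg ifg measurableT.
rewrite preimage_setT => <-.
by apply: eq_measure_integral => A mA _; exact: fmu.
Qed.

End measure_preserving.

Section lebesgue_shear.
Context {R : realType}.
Local Notation mR := (measurableTypeR R).
Local Notation leb := (@lebesgue_measure R).
Local Notation leb2 := (leb \x leb)%E.
Implicit Types phi : mR -> mR.

Lemma lebesgue_measure_translate (c : R) :
  measure_preserving leb (fun x : mR => x + c : mR).
Proof.
have mt : measurable_fun setT (fun x : mR => x + c : mR).
  by apply: (@measurable_funD _ _ _ _ (fun x => x) (cst c)).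
split=> // A mA; rewrite -/(pushforward leb (fun x : mR => x + c : mR) A).
apply/esym/lebesgue_measure_unique => //= _ [[a b] _ <-].
rewrite /pushforward (_ : _ @^-1` _ = `]a - c, b - c]%classic).
  rewrite !lebesgue_measure_itv/= !lte_fin ltrD2r; case: ifP => // _.
  by rewrite -!EFinB; congr EFin; ring.
by apply/seteqP; split=> x /=; rewrite !in_itv/= ltrBlDr lerBrDr.
Qed.

Definition vshear phi (p : mR * mR) : mR * mR := (p.1, p.2 + phi p.1).
Definition hshear phi (p : mR * mR) : mR * mR := (p.1 + phi p.2, p.2).

Lemma vshear_preserving phi : measurable_fun setT phi ->
  measure_preserving leb2 (vshear phi).
Proof.
move=> mphi; split=> [|A mA].
  apply/measurable_fun_pairP; split; first exact: measurable_fst.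
  apply: (@measurable_funD _ _ R setT snd (phi \o fst)).
    exact: measurable_snd.
  by apply: measurableT_comp => //; exact: measurable_fst.
apply: eq_integral => x _ /=.
rewrite -[RHS](lebesgue_measure_translate (phi x)).2.
  by congr leb; apply/seteqP; split=> y; rewrite /xsection/= !inE.
exact: measurable_xsection.
Qed.

Lemma hshear_preserving phi : measurable_fun setT phi ->
  measure_preserving leb2 (hshear phi).
Proof.
move=> mphi; have mshear : measurable_fun setT (hshear phi).
  apply/measurable_fun_pairP; split; last exact: measurable_snd.
  apply: (@measurable_funD _ _ R setT fst (phi \o snd)).
    exact: measurable_fst.
  by apply: measurableT_comp => //; exact: measurable_snd.
have fubini B : measurable B -> leb2 B = product_measure2 leb leb B.
  move=> mB; apply: product_measure_unique => // C D mC mD.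
  exact: product_measure2E.
split=> // A mA; have mAshear : measurable (hshear phi @^-1` A).
  exact: measurable_preimageT.
rewrite (fubini _ mA) (fubini _ mAshear).
apply: eq_integral => y _ /=.
rewrite -[RHS](lebesgue_measure_translate (phi y)).2.
  by congr leb; apply/seteqP; split=> x; rewrite /ysection/= !inE.
exact: measurable_ysection.
Qed.

End lebesgue_shear.

Section area_theory.
Context {R : realType}.
Implicit Types (u : R[i]) (U : set R[i]).

Lemma open_measurableC U : open U -> measurable U.
Proof. by move=> oU; exact: sub_sigma_algebra. Qed.

Lemma continuous_measurableC (f : R[i] -> R) : continuous f ->
  measurable_fun setT f.
Proof.
move=> /continuousP cf.
apply: (measurability _ (RGenOpens.measurableE R)) => //.
move=> _ [_ [a [b ->] <-]]; rewrite setTI; apply: open_measurableC.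
exact/cf/interval_open.
Qed.

Lemma measurable_mulC u : measurable_fun setT (fun z : R[i] => u * z).
Proof.
apply: (@measurability _ _ _ _ _ _ (@open R[i])) => // _ [U oU <-].
rewrite setTI; apply: open_measurableC; move: U oU; apply/continuousP.
exact: mulrl_continuous.
Qed.

(* A rotation is a product of three shears; [t] is the tangent of half the
   angle, hence [s * t = 1 - c]. *)
Lemma rotation_shears (c s : R) : c ^+ 2 + s ^+ 2 = 1 -> c != -1 ->
  let t := s / (1 + c) in
  (fun z => (c +i* s) * z) \o @of_plane R =
  @of_plane R \o
    (hshear ( *%R (- t)) \o vshear ( *%R s) \o hshear ( *%R (- t))).
Proof.
move=> cs c1 t; apply/funext => -[x y].
rewrite /of_plane /hshear /vshear/=; simpc.
have d0 : 1 + c != 0 by rewrite addrC addr_eq0.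
have tc : t * (1 + c) = s by rewrite divfK.
have st : s * t = 1 - c.
  apply: (mulIf d0); rewrite -mulrA tc -expr2 -[LHS](addKr (c ^+ 2)) cs.
  by ring.
apply/esym; congr (_ +i* _).
  transitivity (x * (1 - s * t) - t * (2 - s * t) * y); first by ring.
  by rewrite st -[X in _ = _ - X * _]tc; ring.
transitivity (s * x + (1 - s * t) * y); first by ring.
by rewrite st; ring.
Qed.

Lemma area_rotation u : normc u = 1 -> measure_preserving area (fun z => u * z).
Proof.
have shears_preserving (c s : R) : c ^+ 2 + s ^+ 2 = 1 -> c != -1 ->
    measure_preserving area (fun z => (c +i* s) * z).
  move=> cs c1.
  apply: (measure_preserving_pushforward _ _ (rotation_shears cs c1)).
  - exact: measurable_of_plane.
  - exact: measurable_mulC.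
  - apply: measure_preserving_comp; last first.
      by apply: hshear_preserving; exact: mulrl_measurable.
    apply: measure_preserving_comp; last first.
      by apply: vshear_preserving; exact: mulrl_measurable.
    by apply: hshear_preserving; exact: mulrl_measurable.
case: u => c s /= cs1; have cs : c ^+ 2 + s ^+ 2 = 1.
  by rewrite -[LHS]sqr_sqrtr ?addr_ge0 ?sqr_ge0// cs1 expr1n.
have [c1|] := eqVneq c (-1); last exact: shears_preserving.
have s0 : s = 0.
  apply/eqP; rewrite -sqrf_eq0; apply/eqP.
  by move: cs; rewrite c1 sqrrN expr1n; lra.
have -> : (fun z => (c +i* s) * z) =
    (fun z => (0 +i* 1) * z) \o (fun z => (0 +i* 1) * z).
  by apply/funext => -[x y] /=; rewrite c1 s0; simpc.
have i_preserving : measure_preserving area (fun z : R[i] => (0 +i* 1) * z).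
  apply: shears_preserving; first by rewrite expr0n expr1n add0r.
  by rewrite eq_sym oppr_eq0 oner_neq0.
exact: measure_preserving_comp.
Qed.

Lemma area_open_gt0 U : open U -> U !=set0 -> (0 < area U)%E.
Proof.
move=> oU [[x y] Uxy]; have Unbhs : nbhs (x +i* y) U by exact: open_nbhs_nbhs.
have [[A B] [/= /nbhs_ballP[a /= a0 xA] /nbhs_ballP[b /= b0 yB]] AB_U] :=
  continuous_complex (x := (x, y)) Unbhs.
pose I : set (measurableTypeR R) := ball (x : R) a.
pose J : set (measurableTypeR R) := ball (y : R) b.
have mI : measurable I by exact: measurable_ball.
have mJ : measurable J by exact: measurable_ball.
have IJ_U : I `*` J `<=` @of_plane R @^-1` U.
  by move=> p [Ip Jp]; apply: AB_U; split; [exact: xA|exact: yB].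
apply: (@lt_le_trans _ _ ((lebesgue_measure \x lebesgue_measure)%E (I `*` J))).
  rewrite product_measure1E//= /I /J !lebesgue_measure_ball ?ltW//.
  by rewrite -EFinM lte_fin mulr_gt0// pmulrn_lgt0.
apply: le_measure => //; rewrite inE; first exact: measurableX.
apply: measurable_preimageT; first exact: measurable_of_plane.
exact: open_measurableC.
Qed.

End area_theory.

Section disk_uniform_theory.
Context {R : realType}.
Variables (r : R) (r0 : 0 < r).

Lemma disk_uniformE (A : set R[i]) :
  disk_uniform r0 A = ((pi * r ^+ 2)^-1%:E * area (A `&` disk r))%E.
Proof. by []. Qed.

Lemma disk_uniform_rotation (u : R[i]) : normc u = 1 ->
  measure_preserving (disk_uniform r0) (fun z => u * z).
Proof.
move=> u1; split=> [|A mA]; first exact: measurable_mulC.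
rewrite !disk_uniformE; congr (_ * _)%E; rewrite -[RHS](area_rotation u1).2.
  by congr area; apply/seteqP; split=> z; rewrite diskE/= normcM u1 mul1r.
by apply: measurableI => //; exact: measurable_disk.
Qed.

Lemma disk_uniform_setC_disk : disk_uniform r0 (~` disk r) = 0%E.
Proof. by rewrite disk_uniformE setICl measure0 mule0. Qed.

Lemma disk_uniform_disk (s : R) : 0 <= s <= r ->
  disk_uniform r0 (disk s) = (s ^+ 2 / r ^+ 2)%:E.
Proof.
move=> /andP[s0 sr]; rewrite disk_uniformE.
have -> : disk s `&` disk r = disk s.
  by apply/setIidl; exact: sub_disk.
move: s0; rewrite le_eqVlt => /orP[/eqP<-|s0].
  by rewrite disk0 measure0 mule0 expr0n mul0r.
rewrite area_disk// -EFinM; congr EFin; have := pi_gt0 R.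
by move: (pi : R) => p p0; field; rewrite (gt_eqF r0) (gt_eqF p0).
Qed.

Lemma disk_uniform_annulus m j : (j < m)%N ->
  disk_uniform r0
    (disk (annulus_radius r m j.+1) `\` disk (annulus_radius r m j)) =
  (m%:R^-1)%:E.
Proof.
move=> jm; have j_le_m := ltnW jm; have m0 := leq_ltn_trans (leq0n j) jm.
have mR_gt0 : 0 < m%:R :> R by rewrite ltr0n.
rewrite measureD; [|exact: measurable_disk|exact: measurable_disk|]; last first.
  rewrite (le_lt_trans (probability_le1 _ _)) ?ltry//.
  exact: measurable_disk.
rewrite (_ : disk _ `&` disk _ = disk (annulus_radius r m j)); last first.
  by apply/setIidr/sub_disk; rewrite ler_annulus_radius.
rewrite /= !disk_uniform_disk ?annulus_radius_ge0 ?annulus_radius_le//.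
rewrite -EFinB !sqr_annulus_radius; congr EFin; rewrite -natr1; field.
by rewrite (gt_eqF r0) (gt_eqF mR_gt0).
Qed.

Lemma disk_sub_support (E : set R[i]) :
  closed E -> disk_uniform r0 (~` E) = 0%E -> disk r `<=` E.
Proof.
move=> cE E0 z zr; apply: contrapT => zE.
have /area_open_gt0 : open (~` E `&` disk r).
  by apply: openI; [exact: closed_openC|exact: open_disk].
move=> /(_ (ex_intro _ z (conj zE zr))); apply/negP; rewrite -leNgt le_eqVlt.
move/eqP: E0; rewrite disk_uniformE mule_eq0 eqe invr_eq0 mulf_eq0 expf_eq0/=.
by rewrite (gt_eqF r0) (gt_eqF (pi_gt0 R))/= => ->.
Qed.

End disk_uniform_theory.

(** * Averages over annuli and rotations *)

Lemma Rintegral_sum {R : realType} d (T : measurableType d)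
    (mu : {measure set T -> \bar R}) (I : Type) (s : seq I) (f : I -> T -> R) :
  (forall i, mu.-integrable setT (EFin \o f i)) ->
  \int[mu]_x (\sum_(i <- s) f i x) = \sum_(i <- s) \int[mu]_x f i x.
Proof.
move=> fi; rewrite sum_fine => [|i _]; last exact: integrable_fin_num (fi i).
rewrite -integral_sum//; congr fine.
by apply: eq_integral => x _; rewrite sumEFin.
Qed.

Lemma le_Rintegral_chain {R : realType} d (T : measurableType d)
    (mu : {finite_measure set T -> \bar R}) (F : nat -> set T) (g : T -> R)
    (c : nat -> R) n :
  (forall j, measurable (F j)) -> F 0%N = set0 -> (forall j, F j `<=` F j.+1) ->
  mu.-integrable setT (EFin \o g) ->
  (forall j x, (j < n)%N -> (F j.+1 `\` F j) x -> g x <= c j) ->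
  \int[mu]_(x in F n) g x <= \sum_(j < n) c j * fine (mu (F j.+1 `\` F j)).
Proof.
move=> mF F0 F_sub ig.
have int_g A (mA : measurable A) : mu.-integrable A (EFin \o g).
  exact: integrableS measurableT mA (@subsetT _ A) ig.
elim: n => [_|n ih gc]; first by rewrite F0 Rintegral_set0 big_ord0.
have mD := measurableD (mF n.+1) (mF n).
rewrite -{1}(setDUK (F_sub n)) Rintegral_setU//; last 2 first.
- by apply: int_g; exact: measurableU.
- by rewrite disj_set2E setDIK.
rewrite big_ord_recr lerD ?ih//=.
  by move=> j x jn; apply: gc; exact: ltnW.
rewrite -Rintegral_cst// le_Rintegral//; first exact: int_g.
  exact: finite_measure_integrable_cst.
by move=> x; exact: gc.
Qed.

Section disk_integral.
Context {R : realType}.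
Variables (r : R) (r0 : 0 < r).
Local Notation mu := (disk_uniform r0).
Implicit Types (f : R[i] -> R) (c : nat -> R).

Lemma disk_integrable f : continuous f -> mu.-integrable setT (EFin \o f).
Proof.
move=> cf; have mf := continuous_measurableC cf.
have mD : measurable (disk r : set R[i]) by exact: measurable_disk.
have /integrableP[_ f_fin] : mu.-integrable (disk r) (EFin \o f).
  apply: measurable_bounded_integrable => //.
  - by rewrite (le_lt_trans (probability_le1 _ mD))// ltry.
  - exact: measurable_funTS.
  - have /compact_bounded : compact (f @` [set z | normc z <= r]).
      apply: continuous_compact; last exact: compact_closed_disk.
      exact: continuous_subspaceT.
    move=> [M [Mr fM]]; exists M; split=> // x Mx z; rewrite diskE => /ltW zr.
    by apply: (fM x Mx); exists z.
apply/integrableP; split; first exact/measurable_EFinP.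
rewrite (ge0_negligible_integral (measurableC mD))//.
- by rewrite setTD setCK.
- by apply: measurableT_comp => //; exact/measurable_EFinP.
- exact: disk_uniform_setC_disk.
Qed.

Lemma disk_Rintegral f : mu.-integrable setT (EFin \o f) ->
  \int[mu]_z f z = \int[mu]_(z in disk r) f z.
Proof.
move=> fi; have mD := measurable_disk r.
rewrite /Rintegral (negligible_integral (measurableC mD) _ fi)//; last first.
  exact: disk_uniform_setC_disk.
by rewrite setTD setCK.
Qed.

Lemma disk_Rintegral_le m f c : (0 < m)%N -> mu.-integrable setT (EFin \o f) ->
  (forall j z, (j < m)%N ->
    annulus_radius r m j <= normc z < annulus_radius r m j.+1 -> f z <= c j) ->
  \int[mu]_z f z <= m%:R^-1 * \sum_(j < m) c j.
Proof.
move=> m0 fi fc.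
rewrite disk_Rintegral// -[in disk r](annulus_radius_last r m0).
pose D j : set R[i] := disk (annulus_radius r m j).
apply: (le_trans (le_Rintegral_chain (c := c) (F := D) _ _ _ fi _)).
- by move=> j; exact: measurable_disk.
- by rewrite /D annulus_radius0 disk0.
- by move=> j; apply: sub_disk; rewrite ler_annulus_radius.
- move=> j z jm; rewrite /D !diskE => -[/= zj /negP]; rewrite -leNgt => jz.
  by apply: fc => //; rewrite jz.
rewrite mulr_sumr; apply: ler_sum => j _.
by rewrite /= (disk_uniform_annulus r0 (ltn_ord j)) mulrC.
Qed.

Lemma disk_Rintegral_dist m f c (e : R) : (0 < m)%N ->
  mu.-integrable setT (EFin \o f) ->
  (forall j z, (j < m)%N ->
    annulus_radius r m j <= normc z < annulus_radius r m j.+1 ->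
    `|f z - c j| <= e) ->
  `|\int[mu]_z f z - m%:R^-1 * \sum_(j < m) c j| <= e.
Proof.
move=> m0 fi fc; have mR_neq0 : m%:R != 0 :> R by rewrite pnatr_eq0 -lt0n.
have mean_e : m%:R^-1 * \sum_(j < m) e = e.
  by rewrite sumr_const card_ord -[X in _ * X]mulr_natl mulKf.
have upper : \int[mu]_z f z <= m%:R^-1 * \sum_(j < m) (c j + e).
  apply: (@disk_Rintegral_le _ _ (fun j => c j + e)) => // j z jm /(fc j z jm).
  by rewrite ler_distl => /andP[].
have lower : \int[mu]_z (- 1 * f z) <= m%:R^-1 * \sum_(j < m) (- c j + e).
  apply: (@disk_Rintegral_le _ _ (fun j => - c j + e)) => //.
    exact: (integrableZl measurableT (-1 : R) fi).
  by move=> j z jm /(fc j z jm); rewrite ler_distl mulN1r => /andP[+ _]; lra.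
rewrite RintegralZl// mulN1r in lower; move: upper lower.
rewrite !big_split/= !mulrDr mean_e sumrN mulrN ler_distl => up lo.
by apply/andP; split; lra.
Qed.

End disk_integral.

Section rotation_average.
Context {R : realType}.
Implicit Types (f : R[i] -> R) (N : nat) (z w : R[i]).

Definition rotation_average N f z :=
  N%:R^-1 * \sum_(k < N) f (unit_root N ^+ k * z).

Lemma continuous_rotation_average N f : continuous f ->
  continuous (rotation_average N f).
Proof.
move=> cf z; apply: (@continuous_comp _ _ _
  (fun z => \sum_(k < N) f (unit_root N ^+ k * z)) ( *%R N%:R^-1)); last first.
  exact: mulrl_continuous.
apply: (cvg_big add_continuous (F := nbhs z)) => k _.
by apply: continuous_comp; [exact: mulrl_continuous|exact: cf].
Qed.

Lemma rotation_average_unit_root N f l z : (0 < N)%N ->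
  rotation_average N f (unit_root N ^+ l * z) = rotation_average N f z.
Proof.
move=> N0; elim: l z => [|l ih] z; first by rewrite expr0 mul1r.
rewrite exprSr -mulrA ih /rotation_average; congr (_ * _).
have := prim_expr_order (unit_root_prim (R := R) N0).
case: N {N0 ih} => [|N] rootN; first by rewrite !big_ord0.
rewrite big_ord_recr [RHS]big_ord_recl/= addrC; congr (_ + _).
  by rewrite mulrA -exprSr rootN expr0.
by apply: eq_bigr => k _; rewrite mulrA -exprSr.
Qed.

Lemma rotation_average_dist N f (d e : R) z w : (0 < N)%N ->
  (forall z w, normc (z - w) < d -> `|f z - f w| <= e) -> normc (z - w) < d ->
  `|rotation_average N f z - rotation_average N f w| <= e.
Proof.
move=> N0 f_d zw; have NR_gt0 : 0 < N%:R :> R by rewrite ltr0n.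
rewrite /rotation_average -mulrBr -sumrB normrM normfV (gtr0_norm NR_gt0).
rewrite ler_pdivrMl//; apply: (le_trans (ler_norm_sum _ _ _)).
rewrite mulr_natl -[N in leRHS]card_ord -sumr_const; apply: ler_sum => k _.
by apply: f_d; rewrite -mulrBr normcM normcX normc_unit_root expr1n mul1r.
Qed.

Lemma Rintegral_rotation_average (r : R) (r0 : 0 < r) N f : (0 < N)%N ->
  continuous f ->
  \int[disk_uniform r0]_z rotation_average N f z = \int[disk_uniform r0]_z f z.
Proof.
move=> N0 cf; have int_rot k : (disk_uniform r0).-integrable setT
    (EFin \o (fun z => f (unit_root N ^+ k * z))).
  apply: disk_integrable => z.
  by apply: continuous_comp; [exact: mulrl_continuous|exact: cf].
under eq_Rintegral do rewrite /rotation_average mulr_sumr.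
rewrite Rintegral_sum => [|k]; last first.
  exact: (integrableZl measurableT (N%:R^-1 : R) (int_rot k)).
rewrite (eq_bigr (fun=> N%:R^-1 * \int[disk_uniform r0]_z f z)) => [|k _].
  by rewrite sumr_const card_ord -[LHS]mulr_natl mulVKf// pnatr_eq0 -lt0n.
rewrite RintegralZl//; congr (_ * _).
apply: (Rintegral_measure_preserving (f := fun z => unit_root N ^+ k * z)).
- by apply: disk_uniform_rotation; rewrite normcX normc_unit_root expr1n.
- exact: continuous_measurableC.
- exact: int_rot.
Qed.

End rotation_average.

(** * Conjugate averages and equidistribution *)

Lemma ln_prod {R : realType} (I : Type) (s : seq I) (F : I -> R) :
  (forall i, 0 < F i) ->
  ln (\prod_(i <- s) F i) = \sum_(i <- s) ln (F i).
Proof.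
move=> F0; elim: s => [|i s ih]; first by rewrite !big_nil ln1.
by rewrite !big_cons -ih lnM ?posrE// prodr_gt0.
Qed.

Section conjugate_average.
Context {R : realType}.
Implicit Types (z : R[i]) (f : R[i] -> R).

Definition conjugate_average z f :=
  (algdegree z)%:R^-1 * \sum_(b <- galois_conjugates z) f b.

Lemma ge0_integral_conjugate_measure z f : measurable_fun setT f ->
  (forall x, 0 <= f x) ->
  (\int[conjugate_measure z]_x (f x)%:E = (conjugate_average z f)%:E)%E.
Proof.
move=> mf f0.
have mEf : measurable_fun setT (EFin \o f) by exact/measurable_EFinP.
rewrite ge0_integral_mscale//; last by move=> x _; rewrite lee_fin.
rewrite ge0_integral_measure_sum//; last by move=> x _; rewrite lee_fin.
rewrite EFinM; congr (_ * _)%E.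
under eq_bigr do rewrite integral_dirac// diracT mul1e.
by rewrite (big_nth 0) big_mkord sumEFin.
Qed.

Lemma integral_conjugate_measure z f : measurable_fun setT f ->
  (\int[conjugate_measure z]_x (f x)%:E = (conjugate_average z f)%:E)%E.
Proof.
move=> mf; rewrite integralE funerpos funerneg.
rewrite !ge0_integral_conjugate_measure; last 4 first.
- exact: measurable_funrneg.
- exact: funrneg_ge0.
- exact: measurable_funrpos.
- exact: funrpos_ge0.
rewrite -EFinB /conjugate_average -mulrBr -sumrB; congr (_ * _)%:E.
by apply: eq_bigr => b _; rewrite -[in RHS](funrposBneg f).
Qed.

Lemma conjugate_average_circle_points z f m N rho : algebraic_integer z ->
  perm_eq (galois_conjugates z) (circle_points m N rho) ->
  conjugate_average z f =
  m%:R^-1 * \sum_(j < m) rotation_average N f (rho j)%:C.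
Proof.
move=> az gc; rewrite /conjugate_average -size_galois_conjugates//.
rewrite (perm_size gc) (perm_big _ gc) size_allpairs !size_iota !subn0.
rewrite natrM invfM -mulrA; congr (_ * _).
rewrite big_allpairs_dep/= big_mkord mulr_sumr; apply: eq_bigr => j _.
by rewrite big_mkord; congr (_ * _); apply: eq_bigr => k _; rewrite mulrC.
Qed.

Lemma conjugate_average0 f : conjugate_average 0 f = f 0.
Proof.
have [a0 gc0] := @galois_conjugates0 R.
rewrite /conjugate_average -size_galois_conjugates// gc0 big_seq1.
by rewrite invr1 mul1r.
Qed.

Lemma conjugate_average_ln_ge0 z (d : R) :
  algebraic_integer z -> z != 0 -> 0 < d ->
  0 <= conjugate_average z (fun b => ln (Num.max (normc b) d)).
Proof.
move=> az z0 d0; rewrite mulr_ge0 ?invr_ge0// -ln_prod => [|b]; last first.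
  by rewrite lt_max d0 orbT.
rewrite ln_ge0// (le_trans (prod_normc_galois_conjugates_ge1 az z0))//.
by apply: ler_prod => b _; rewrite normc_ge0 le_max lexx.
Qed.

End conjugate_average.

Section disk_equidistribution.
Context {R : realType}.
Variables (r : R) (r0 : 0 < r).
Local Notation mu := (disk_uniform r0).

Lemma weak_star_conjugateP (alpha : nat -> R[i]) :
  weak_star_cvg (fun n => conjugate_measure (alpha n)) mu <->
  (forall f, continuous f -> compact_support f ->
    conjugate_average (alpha n) f @[n --> \oo] --> \int[mu]_z f z).
Proof.
have fin_f (f : R[i] -> R) : continuous f ->
    (\int[mu]_z (f z)%:E)%E \is a fin_num.
  by move=> cf; exact: integrable_fin_num (disk_integrable r0 cf).
have avgE (f : R[i] -> R) : continuous f ->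
    (fun n => \int[conjugate_measure (alpha n)]_z (f z)%:E)%E =
    EFin \o (fun n => conjugate_average (alpha n) f).
  move=> cf; apply/funext => n; rewrite integral_conjugate_measure//.
  exact: continuous_measurableC.
split=> wc f cf kf; have := wc f cf kf.
  by rewrite avgE// -(fineK (fin_f f cf)) => /fine_cvg.
move=> cvg_f; rewrite avgE// -[X in _ --> X](fineK (fin_f f cf)).
by apply: cvg_EFin => //; exact: nearW.
Qed.

(* Up to a rotation by a power of [unit_root N], which does not change the
   rotation average, [z] is close to its modulus, and so to [rho j]. *)
Lemma disk_equidistribution (f : R[i] -> R) (e : R) : continuous f ->
  compact_support f -> 0 < e ->
  exists n0, forall m N rho, (n0 < m)%N -> (n0 < N)%N ->
    interlaces m (annulus_radius r m) rho ->
    `|\int[mu]_z f z - m%:R^-1 * \sum_(j < m) rotation_average N f (rho j)%:C|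
      <= e.
Proof.
move=> cf kf e0; have [d d0 f_d] := compact_support_unif_continuous cf kf e0.
have d2_gt0 : 0 < d / 2 by rewrite divr_gt0.
have [m_min _ width_lt] := near_annulus_width_lt r0 d2_gt0.
have [N_min _ rotate] := near_rotate_real (divr_gt0 d2_gt0 r0).
exists (maxn m_min N_min) => m N rho; rewrite !gtn_max.
move=> /andP[m_lt _] /andP[_ N_lt] rhoP.
have m0 : (0 < m)%N := leq_ltn_trans (leq0n m_min) m_lt.
have N0 : (0 < N)%N := leq_ltn_trans (leq0n N_min) N_lt.
rewrite -(Rintegral_rotation_average r0 N0 cf).
apply: (disk_Rintegral_dist
  (c := fun j => rotation_average N f (rho j)%:C)) => //.
  exact/disk_integrable/continuous_rotation_average.
move=> j z jm /andP[jz zj]; have [l zl] := rotate N (ltnW N_lt) z.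
rewrite -(rotation_average_unit_root f l z N0).
apply: (rotation_average_dist (d := d)) => // [w w' /f_d/ltW//|].
rewrite -(subrKA (normc z)%:C) (le_lt_trans (le_normcD _ _))// [ltRHS]splitr.
rewrite ltr_leD//.
  rewrite (le_lt_trans zl)// mulrAC ltr_pdivrMr// ltr_pM2l//.
  by rewrite (lt_le_trans zj)// annulus_radius_le.
rewrite -rmorphB normc_real (le_trans _ (ltW (width_lt m (ltnW m_lt))))//.
apply: le_trans (annulus_width_le r0 m0 j); have /andP[jrho rhoj] := rhoP j jm.
by rewrite ler_norml; apply/andP; split; lra.
Qed.

End disk_equidistribution.

(** * Sufficiency *)

Lemma arithmetic_of_ge {R : realType} (r : R) (r0 : 0 < r) (E : set R[i]) :
  compact E -> disk_uniform r0 (~` E) = 0%E -> expR (1 / 2) <= r ->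
  arithmetic_measure E (disk_uniform r0).
Proof.
move=> kE E0 er; have rE : disk r `<=` E.
  by apply: disk_sub_support E0; exact: compact_closed.
have /choice[alpha alphaP] : forall n, exists z : R[i], exists N rho,
    [/\ (n < N)%N, algebraic_integer z,
        interlaces n.+1 (annulus_radius r n.+1) rho
      & perm_eq (galois_conjugates z) (circle_points n.+1 N rho)].
  move=> n; have near_z := near_conjugates_on_circles er (ltn0Sn n).
  have [N [nN [z [rho [az rhoP gc]]]]] :=
    filter_ex (filterI (nbhs_infty_gt n) near_z).
  by exists z, N, rho.
exists alpha; split.
- by move=> n; have [N [rho []]] := alphaP n.
- move=> U _ EU; exists 0%N => n _ b; have [N [rho [_ _ rhoP gc]]] := alphaP n.
  rewrite (perm_mem gc) => /normc_circle_points[j jn bE].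
  have /andP[jrho rhoj] := rhoP j jn.
  apply/EU/rE; rewrite diskE/= bE ger0_norm; last first.
    by rewrite (le_trans _ (ltW jrho))// annulus_radius_ge0.
  by rewrite (lt_le_trans rhoj)// annulus_radius_le.
- apply/weak_star_conjugateP => f cf kf; apply/cvgrPdist_le => e e0.
  have [n0 dist_f] := disk_equidistribution r0 cf kf e0.
  exists n0 => // n /= n0n; have [N [rho [nN az rhoP gc]]] := alphaP n.
  rewrite (conjugate_average_circle_points _ az gc).
  by apply: dist_f; rewrite ?ltnS// (leq_ltn_trans n0n).
Qed.

(** * Necessity *)

Section plateau.
Context {R : realType}.
Implicit Types (b t : R).

Definition plateau b t : R := Num.min 1 (Num.max 0 (b + 1 - t)).

Lemma continuous_plateau b : continuous (plateau b).
Proof.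
have cmax : continuous (fun t : R => Num.max 0 (b + 1 - t)).
  apply: max_fun_continuous => t; first exact: cvg_cst.
  by apply: cvgB; [exact: cvg_cst|exact: cvg_id].
by apply: min_fun_continuous => // t; exact: cvg_cst.
Qed.

Lemma plateau_eq1 b t : t <= b -> plateau b t = 1.
Proof.
by move=> tb; apply/min_idPl; rewrite le_max lerBrDr addrC lerD2r tb orbT.
Qed.

Lemma plateau_eq0 b t : b + 1 <= t -> plateau b t = 0.
Proof.
move=> bt; rewrite /plateau (_ : Num.max _ _ = 0); first exact/min_idPr.
by apply/max_idPl; rewrite subr_le0.
Qed.

Lemma compact_support_plateau (f : R[i] -> R) b :
  compact_support (fun z => f z * plateau b (normc z)).
Proof.
apply: (subclosed_compact _ (@compact_closed_disk R (b + 1))).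
  exact: closed_closure.
have /closure_id -> : closed [set z : R[i] | normc z <= b + 1].
  by apply: compact_closed; [exact: norm_hausdorff|exact: compact_closed_disk].
apply: closureS => z /=; apply: contra_neqT; rewrite -ltNge => /ltW bz.
by rewrite plateau_eq0// mulr0.
Qed.

End plateau.

Section necessity.
Context {R : realType}.
Variables (r : R) (r0 : 0 < r) (E : set R[i]) (alpha : nat -> R[i]).
Local Notation mu := (disk_uniform r0).
Hypotheses (compactE : compact E)
  (conj_near_E : forall U : set R[i], open U -> E `<=` U -> exists n0 : nat,
    forall n, (n0 <= n)%N -> forall b, b \in galois_conjugates (alpha n) -> U b)
  (conj_cvg : weak_star_cvg (fun n => conjugate_measure (alpha n)) mu).

(* The conjugates stay in a bounded set, so the support condition on test
   functions is not needed. *)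
Lemma conjugate_average_cvg (f : R[i] -> R) : continuous f ->
  conjugate_average (alpha n) f @[n --> \oo] --> \int[mu]_z f z.
Proof.
move=> cf; have [b [Eb rb]] := filter_ex
  (filterI (compact_sub_disk compactE) (nbhs_pinfty_ge (num_real r))).
pose g z := f z * plateau b (normc z).
have gE z : disk b z -> g z = f z.
  by rewrite diskE => /ltW zb; rewrite /g plateau_eq1 ?mulr1.
have cg : continuous g.
  move=> z; apply: (@cvgM _ _ (nbhs z) _ f (fun z => plateau b (normc z))).
    exact: cf.
  apply: continuous_comp; first exact: continuous_normc.
  exact: continuous_plateau.
have kg : compact_support g by exact: compact_support_plateau.
have <- : \int[mu]_z g z = \int[mu]_z f z.
  rewrite !disk_Rintegral; [|exact: disk_integrable..].
  by apply: eq_Rintegral => z; rewrite inE => /(sub_disk rb)/gE.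
have [n0 conj_b] := conj_near_E (@open_disk R b) Eb.
have /weak_star_conjugateP/(_ g cg kg) := conj_cvg; apply: cvg_trans.
apply: near_eq_cvg; exists n0 => // n /= n0n; congr (_ * _).
by apply: eq_big_seq => w /(conj_b n n0n)/gE.
Qed.

(* The average of the modulus is 0 at 0, but has a positive limit. *)
Lemma near_alpha_neq0 : \forall n \near \oo, alpha n != 0.
Proof.
have cont_opp_normc : continuous (fun z : R[i] => - normc z).
  move=> z; apply: continuous_comp; first exact: continuous_normc.
  exact: opp_continuous.
have : \int[mu]_z - normc z < 0.
  pose c j := if j is 0 then 0 else - annulus_radius r 2 1.
  apply: (@le_lt_trans _ _ (2^-1 * \sum_(j < 2) c j)).
    apply: disk_Rintegral_le => //; first exact: disk_integrable.
    by move=> [|[|//]] z _ /andP[jz _]; rewrite ?lerN2// oppr_le0 normc_ge0.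
  rewrite !big_ord_recl big_ord0/= add0r addr0 pmulr_rlt0 ?invr_gt0//.
  by rewrite oppr_lt0 annulus_radius_gt0.
move=> /(cvgr_lt _ (conjugate_average_cvg cont_opp_normc)); apply: filterS => n.
by apply: contraTneq => ->; rewrite conjugate_average0 normc0 oppr0 ltxx.
Qed.

Lemma continuous_ln_max (d : R) : 0 < d ->
  continuous (fun z : R[i] => ln (Num.max (normc z) d)).
Proof.
move=> d0 z.
apply: (@continuous_comp _ _ _ (fun z => Num.max (normc z) d) (@ln R)).
  apply: max_fun_continuous => w; first exact: continuous_normc.
  exact: cst_continuous.
by apply: continuous_ln; rewrite lt_max d0 orbT.
Qed.

Lemma disk_Rintegral_ln_lt0 : r < expR (1 / 2) -> exists2 d, 0 < d &
  \int[mu]_z ln (Num.max (normc z) d) < 0.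
Proof.
move=> re; have [|m m0 prod_lt1] := @exists_prod_annulus_radius_lt1 R r.
  exact/andP.
pose t j := annulus_radius r m j.+1.
have t_gt0 j : 0 < t j by exact: annulus_radius_gt0.
exists (t 0%N) => //.
apply: (@le_lt_trans _ _ (m%:R^-1 * \sum_(j < m) ln (t j))).
  apply: (disk_Rintegral_le (c := fun j => ln (t j))) => //.
    exact/disk_integrable/continuous_ln_max.
  move=> j z jm /andP[_ zj]; rewrite ler_ln ?posrE ?lt_max ?t_gt0 ?orbT//.
  by rewrite ge_max (ltW zj) ler_annulus_radius.
rewrite pmulr_rlt0 ?invr_gt0 ?ltr0n// -ln_prod// ln_lt0// prod_lt1 andbT.
by apply: prodr_gt0.
Qed.

Lemma ge_of_conjugates_cvg : (forall n, algebraic_integer (alpha n)) ->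
  expR (1 / 2) <= r.
Proof.
move=> int_alpha; rewrite leNgt; apply/negP => /disk_Rintegral_ln_lt0[d d0].
move=> /(cvgr_lt _ (conjugate_average_cvg (continuous_ln_max d0))) avg_lt0.
have [n [alpha_neq0]] := filter_ex (filterI near_alpha_neq0 avg_lt0).
by rewrite ltNge conjugate_average_ln_ge0.
Qed.

End necessity.

Theorem theorem6p7 (R : realType) (r : R) (r0 : 0 < r) (E : set R[i])
  (compactE : compact E) (symE : conj_symmetric E)
  (suppE : disk_uniform r0 (~` E) = 0%E) :
  arithmetic_measure E (disk_uniform r0) <-> expR (1 / 2) <= r.
Proof.
split=> [[alpha [int_alpha conj_near_E conj_cvg]]|].
  exact: ge_of_conjugates_cvg compactE conj_near_E conj_cvg int_alpha.
exact: arithmetic_of_ge.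
Qed.
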